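(* Let $\mathbb{K}$ be a field, $n\in\mathbb{N}$, $\mathbf{m}=(m_1,\dots,m_n)\in\mathbb{N}^n$ with $m_i\le2$ for all $i$, and let $R=\mathbb{K}[X_{ij}\mid1\le i\le n,\ 1\le j\le m_i]$ be $\mathbb{Z}^n$-graded by $\deg X_{ij}=\mathbf{e}_i$. Then the following two statements are equivalent for a formal Laurent series $H\in\mathbb{Z}(\!(t_1,\dots,t_n)\!)$: (1) There exists a finitely generated $\mathbb{Z}^n$-graded $R$-module $M$ whose Hilbert series equals $H$. (2) $H$ satisfies the following two conditions: (a) $H\ge0$, i.e. every coefficient of $H$ is nonnegative; and (b) $H\cdot\prod_{i=1}^n(1-t_i)^{m_i}$ is a Laurent polynomial.
   Context: $\mathbb{N}$ contains $0$; $\mathbf{e}_i$ is the $i$-th unit vector of $\mathbb{Z}^n$. $\mathbb{Z}(\!(t_1,\dots,t_n)\!)$ is the ring of formal series $\sum_{\mathbf{a}\in\mathbb{Z}^n}c_{\mathbf{a}}\mathbf{t}^{\mathbf{a}}$ with integer coefficients for which there is $\mathbf{b}\in\mathbb{Z}^n$ with $c_{\mathbf{a}}=0$ unless $\mathbf{a}\ge\mathbf{b}$ componentwise. The Hilbert series of a finitely generated graded module $M$ is $H_M=\sum_{\mathbf{a}\in\mathbb{Z}^n}(\dim_{\mathbb{K}}M_{\mathbf{a}})\,t_1^{a_1}\cdots t_n^{a_n}$. *)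

(* Defs.v *)
From HB Require Import structures.
From mathcomp Require Import all_boot all_order all_algebra.
From mathcomp Require Import finmap.
From mathcomp Require Import boolp classical_sets cardinality fsbigop.
From mathcomp Require Import monalg.

Set Implicit Arguments.
Unset Strict Implicit.
Unset Printing Implicit Defensive.

Import Order.TTheory GRing.Theory Num.Theory.
Local Open Scope ring_scope.

(* The degree group Z^n; its addition is the pointwise one of {ffun _ -> _}. *)
Notation zdeg n := {ffun 'I_n -> int}.

Definition unit_vec n (i : 'I_n) : zdeg n := [ffun k => (k == i)%:R].

Definition le_deg n (b a : zdeg n) : Prop := forall i, b i <= a i.

(* Z((t_1, ..., t_n)): coefficient families on Z^n that vanish outside the
   up-set of some degree. *)
Record laurent (n : nat) := Laurent {
  lcoef :> zdeg n -> int;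
  lbounded : exists b, forall a, ~ le_deg b a -> lcoef a = 0 }.

Arguments Laurent {n} lcoef lbounded.

Lemma laurentP n (F G : laurent n) : lcoef F =1 lcoef G -> F = G.
Proof.
case: F G => f hf [g hg] /= fg.
have e : f = g by apply: funext.
by case: _ / e in hg fg *; congr Laurent; exact: Prop_irrelevance.
Qed.

HB.instance Definition _ n := gen_eqMixin (laurent n).
HB.instance Definition _ n := gen_choiceMixin (laurent n).

Lemma finite_box n (l u : zdeg n) :
  finite_set [set b : zdeg n | le_deg l b /\ le_deg b u].
Proof.
pose N := (\sum_i `|u i - l i|%N)%N.
pose h (c : {ffun 'I_n -> 'I_N.+1}) : zdeg n := [ffun i => l i + (c i : nat)%:Z].
apply: (@sub_finite_set _ _ (range h)); last exact/finite_image/finite_finset.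
move=> b [lb bu]; exists [ffun i => inord `|b i - l i|%N] => //.
apply/ffunP => i; rewrite !ffunE inordK.
  by rewrite gez0_abs ?subr_ge0 ?lb // addrCA subrr addr0.
rewrite ltnS /N (bigD1 i) //=; apply: leq_trans (leq_addr _ _).
rewrite -lez_nat !gez0_abs ?subr_ge0 ?lb ?lerB ?bu //.
by apply: le_trans (lb i) (bu i).
Qed.

Section LaurentRing.
Variable n : nat.
Implicit Types (F G H : laurent n) (a b c : zdeg n).

Lemma lzero_bounded :
  exists b : zdeg n, forall a, ~ le_deg b a -> (fun=> 0 : int) a = 0.
Proof. by exists 0. Qed.
Definition lzero := Laurent _ lzero_bounded.

Lemma lopp_bounded F : exists b, forall a, ~ le_deg b a -> - F a = 0.
Proof. by have [b Fb] := lbounded F; exists b => a /Fb ->; rewrite oppr0. Qed.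
Definition lopp F := Laurent _ (lopp_bounded F).

Lemma ladd_bounded F G : exists b, forall a, ~ le_deg b a -> F a + G a = 0.
Proof.
have [b Fb] := lbounded F; have [c Gc] := lbounded G.
exists [ffun i => Order.min (b i) (c i)] => a nle.
rewrite Fb ?Gc ?addr0 // => le; apply: nle => i; rewrite ffunE ge_min le //.
by rewrite orbT.
Qed.
Definition ladd F G := Laurent _ (ladd_bounded F G).

Lemma lmono_bounded d :
  exists b, forall a, ~ le_deg b a -> ((a == d)%:R : int) = 0.
Proof. by exists d => a; case: eqP => // ->; case. Qed.
Definition lmono d := Laurent _ (lmono_bounded d).

(* Cauchy product: the summand vanishes for b outside a finite set, and
   \sum_(b \in A) is the sum over the support. *)
Definition lmul_coef F G a : int :=
  \sum_(b \in [set: zdeg n]) F b * G (a - b).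

Lemma lmul_supp F G : exists f g : zdeg n, forall a b,
  F b * G (a - b) != 0 -> le_deg f b /\ le_deg b (a - g).
Proof.
have [f Ff] := lbounded F; have [g Gg] := lbounded G; exists f, g => a b nz.
split; apply: contrapT => nle; move: nz.
  by rewrite Ff // mul0r eqxx.
rewrite (Gg (a - b)) ?mulr0 ?eqxx // => le; apply: nle => i.
by have := le i; rewrite !ffunE lerBrDl -lerBrDr.
Qed.

Lemma lmul_bounded F G :
  exists b, forall a, ~ le_deg b a -> lmul_coef F G a = 0.
Proof.
have [f [g s]] := lmul_supp F G; exists (f + g) => a nle.
apply: fsbig1 => b _; apply: contra_notP nle => /eqP /s [fb bg] i.
rewrite ffunE; apply: le_trans (lerD (fb i) (lexx _)) _.
by have := bg i; rewrite !ffunE lerBrDr.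
Qed.
Definition lmul F G := Laurent _ (lmul_bounded F G).

Lemma laddA : associative ladd.
Proof. by move=> F G H; apply: laurentP => a /=; rewrite addrA. Qed.
Lemma laddC : commutative ladd.
Proof. by move=> F G; apply: laurentP => a /=; rewrite addrC. Qed.
Lemma ladd0 : left_id lzero ladd.
Proof. by move=> F; apply: laurentP => a /=; rewrite add0r. Qed.
Lemma laddN : left_inverse lzero lopp ladd.
Proof. by move=> F; apply: laurentP => a /=; rewrite addNr. Qed.

HB.instance Definition _ :=
  GRing.isZmodule.Build (laurent n) laddA laddC ladd0 laddN.

Lemma lmulC : commutative lmul.
Proof.
move=> F G; apply: laurentP => a /=; rewrite /lmul_coef.
rewrite (reindex_fsbigT (fun b => a - b)); last first.
  by exists (fun b => a - b) => b; rewrite subKr.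
by apply: eq_fsbigr => b _; rewrite subKr mulrC.
Qed.

Lemma lmonoM d F a : lmul_coef (lmono d) F a = F (a - d).
Proof.
rewrite /lmul_coef -(fsbig_widen [set d]) //.
  by rewrite fsbig_set1 /= eqxx mul1r.
by move=> b [_ /= /eqP/negbTE bd]; rewrite bd mul0r.
Qed.

Lemma lmul1 : left_id (lmono 0) lmul.
Proof. by move=> F; apply: laurentP => a /=; rewrite lmonoM subr0. Qed.

Lemma lmulDl : left_distributive lmul ladd.
Proof.
move=> F G H; apply: laurentP => a /=; rewrite /lmul_coef.
have [f [g s]] := lmul_supp F H; have [f' [g' s']] := lmul_supp G H.
pose A : set (zdeg n) := [set b | le_deg f b /\ le_deg b (a - g)]%classic.
pose B : set (zdeg n) := [set b | le_deg f' b /\ le_deg b (a - g')]%classic.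
have fin : finite_set (A `|` B)%classic.
  by rewrite finite_setU; split; exact: finite_box.
have cut (u : zdeg n -> int) : (forall b, u b != 0 -> (A `|` B)%classic b) ->
    \sum_(b \in [set: zdeg n]) u b = \sum_(b <- fset_set (A `|` B)%classic) u b.
  move=> uAB; rewrite -(fsbig_widen (A `|` B)%classic) ?fsbig_finite //.
  by move=> b [_ /= nAB]; apply: contra_notP nAB => /eqP /uAB.
rewrite !cut.
- by rewrite -big_split; apply: eq_bigr => b _; rewrite mulrDl.
- by move=> b /s'; right.
- by move=> b /s; left.
- move=> b; rewrite mulrDl => nz; have [z|/s] := eqVneq (F b * H (a - b)) 0.
    by move: nz; rewrite z add0r => /s'; right.
  by left.
Qed.

Lemma exchange_lsum (u : zdeg n -> zdeg n -> int) (P Q : set (zdeg n)) :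
  finite_set P -> finite_set Q -> (forall c b, u c b != 0 -> P c /\ Q b) ->
  \sum_(c \in [set: zdeg n]) \sum_(b \in [set: zdeg n]) u c b =
  \sum_(b \in [set: zdeg n]) \sum_(c \in [set: zdeg n]) u c b.
Proof.
move=> fP fQ uPQ.
have e1 c : \sum_(b \in [set: zdeg n]) u c b = \sum_(b \in Q) u c b.
  apply/esym/fsbig_widen => // b [_ /= nQ].
  by apply: contra_notP nQ => /eqP /uPQ [].
have e2 b : \sum_(c \in [set: zdeg n]) u c b = \sum_(c \in P) u c b.
  apply/esym/fsbig_widen => // c [_ /= nP].
  by apply: contra_notP nP => /eqP /uPQ [].
rewrite -(fsbig_widen P setT) //; last first.
  move=> c [_ /= nP]; apply: fsbig1 => b _.
  by apply: contra_notP nP => /eqP /uPQ [].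
rewrite -(fsbig_widen Q setT) //; last first.
  move=> b [_ /= nQ]; apply: fsbig1 => c _.
  by apply: contra_notP nQ => /eqP /uPQ [].
under eq_fsbigr do rewrite e1.
by rewrite exchange_fsbig //; apply: eq_fsbigr => b _; rewrite e2.
Qed.

Lemma lmulA : associative lmul.
Proof.
move=> F G H; apply: laurentP => a /=; rewrite /lmul_coef /= /lmul_coef.
have [f Ff] := lbounded F; have [g Gg] := lbounded G.
have [h Hh] := lbounded H.
under [RHS]eq_fsbigr do rewrite mulr_fsuml.
rewrite (@exchange_lsum _ _ _ (finite_box (f + g) (a - h))
                              (finite_box f (a - h - g))); last first.
  move=> c b nz.
  have fb : le_deg f b.
    by apply: contrapT => nle; move: nz; rewrite Ff // !mul0r eqxx.
  have gb : le_deg g (c - b).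
    by apply: contrapT => nle; move: nz; rewrite Gg // mulr0 mul0r eqxx.
  have hb : le_deg h (a - c).
    by apply: contrapT => nle; move: nz; rewrite Hh // mulr0 eqxx.
  split; split=> // i; move: (fb i) (gb i) (hb i); rewrite !ffunE => fi gi hi.
  - by rewrite -(subrK (b i) (c i)) addrC lerD.
  - by rewrite lerBrDr addrC -lerBrDr.
  - rewrite lerBrDr -lerBrDl; apply: le_trans gi _.
    by rewrite lerB // lerBrDr addrC -lerBrDr.
apply: eq_fsbigr => b _; rewrite mulr_fsumr.
rewrite (reindex_fsbigT (fun c => c - b)); last first.
  by exists (fun c => c + b) => c; rewrite ?subrK ?addrK.
by apply: eq_fsbigr => c _; rewrite mulrA opprB addrA subrK.
Qed.

Lemma lone_neq0 : lmono 0 != 0.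
Proof. by apply/eqP => /(congr1 (fun F : laurent n => F 0)); rewrite /= eqxx. Qed.

HB.instance Definition _ :=
  GRing.Zmodule_isComNzRing.Build (laurent n) lmulA lmulC lmul1 lmulDl lone_neq0.

End LaurentRing.

Definition tvar n (i : 'I_n) : laurent n := lmono (unit_vec i).

Definition is_laurent_poly n (F : laurent n) : Prop :=
  finite_set [set a | F a != 0].

(* (i, j) indexes the variable X_ij. *)
Notation var_index m := {i & 'I_(m i)}.

Notation gpoly K m := {malg K[{cmonom var_index m}]}.

Section GradedPoly.
Variables (K : fieldType) (n : nat) (m : 'I_n -> nat).

Definition Xvar (i : 'I_n) (j : 'I_(m i)) : gpoly K m :=
  << ucm (Tagged (fun i => 'I_(m i)) j) >>.

Definition mon_deg (u : {cmonom var_index m}) : zdeg n :=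
  [ffun i => \sum_(j < m i) (u (Tagged (fun i => 'I_(m i)) j))%:Z].

Definition homog (a : zdeg n) (p : gpoly K m) : Prop :=
  forall u, p@_u != 0 -> mon_deg u = a.

Lemma homog_Xvar i (j : 'I_(m i)) : homog (unit_vec i) (Xvar j).
Proof.
move=> u; rewrite /Xvar mcoeffU1; case: (eqVneq _ u) => [<- _|_]; last by rewrite eqxx.
apply/ffunP => k; rewrite !ffunE; have [-> {k}|ki] := eqVneq k i.
  rewrite (bigD1 j) //= cmU eqxx big1 ?addr0 // => l lj.
  by rewrite cmU eq_Tagged /= eq_sym (negbTE lj).
rewrite big1 // => l _; rewrite cmU; case: eqP => // e.
by case/eqP: ki; exact: (esym (congr1 tag e)).
Qed.

End GradedPoly.

Section GradedModules.
Variables (K : fieldType) (n : nat) (m : 'I_n -> nat).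
Variable M : lmodType (gpoly K m).

Record grading := Grading {
  piece :> zdeg n -> set M;
  piece0 : forall a, piece a 0;
  pieceB : forall a x y, piece a x -> piece a y -> piece a (x - y);
  pieceZ : forall a b p x, homog a p -> piece b x -> piece (a + b) (p *: x);
  piece_sum : forall x, exists (s : seq (zdeg n)) (y : zdeg n -> M),
    (forall a, piece a (y a)) /\ x = \sum_(a <- s) y a;
  piece_direct : forall (s : seq (zdeg n)) (y : zdeg n -> M), uniq s ->
    (forall a, piece a (y a)) -> \sum_(a <- s) y a = 0 ->
    forall a, a \in s -> y a = 0 }.

Definition fin_gen : Prop :=
  exists (r : nat) (g : 'I_r -> M), forall x,
    exists c : 'I_r -> gpoly K m, x = \sum_(i < r) c i *: g i.

(* K acts on M through the constant polynomials k%:A. *)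
Definition is_Kbasis (V : set M) (d : nat) (e : 'I_d -> M) : Prop :=
  [/\ forall i, V (e i),
      forall c : 'I_d -> K, \sum_(i < d) (c i)%:A *: e i = 0 ->
        forall i, c i = 0
    & forall x, V x -> exists c : 'I_d -> K, x = \sum_(i < d) (c i)%:A *: e i].

Definition Kdim (V : set M) (d : nat) : Prop :=
  exists e : 'I_d -> M, is_Kbasis V e.

(* In particular every piece of gr has finite dimension over K. *)
Definition is_hilbert_series (gr : grading) (H : laurent n) : Prop :=
  forall a, exists2 d : nat, Kdim (gr a) d & H a = d%:Z.

End GradedModules.

(* Main.v *)
Require Import Defs.
From HB Require Import structures.
From mathcomp Require Import all_boot all_order all_algebra.
From mathcomp Require Import finmap boolp classical_sets cardinality.
From mathcomp Require Import monalg zify ring.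

(** Write R for the polynomial ring, X_ij for its variables and t^a for a
    monomial of the Laurent ring.

    From a module to conditions (a) and (b).  Nonnegativity holds because the
    coefficients are dimensions.  For (b), take homogeneous generators g_t of M
    and consider the terms (u, t), where u is a monomial of R; the term (u, t)
    stands for the element u g_t of M.  Order the terms totally and compatibly
    with multiplication by monomials.  Call a term nonstandard if its value is
    a K-combination of smaller terms of the same degree.  In each degree the
    standard terms form a basis, so H(a) is the number of standard terms of
    degree a ([count_standard]); and a multiple of a nonstandard term is
    nonstandard ([nonstd_mul]).  By Dickson's lemma the nonstandard terms are
    the multiples of finitely many of them; hence for some N, whether (u, t) is
    standard depends on the exponents of u only through their minima with N
    ([upset_stable]).  Multiplying H by 1 - t_i amounts to replacing a function
    on terms by its difference in the direction of some X_ij.  The indicator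
    function of the standard terms is constant beyond N in every direction, so
    that the difference taken once in each direction is zero as soon as one
    exponent exceeds N ([fiber_sum_laurent_poly]).  This gives (b) for
    arbitrary m.

    From the conditions to a module.  Condition (b) implies that in each single
    direction i, far enough, H is zero, constant or affine, according to
    m_i = 0, 1, 2 ([laurent_poly_tame]); removing the factors 1 - t_j with j
    different from i is harmless because H is bounded below.  A function of one
    integer variable x that is zero far to the left and affine for x >= N is a
    combination of point masses, of the step function of [N, +oo) and of the
    ramp max(0, x - N).  The coefficients of this combination are values of the
    function and its final slope, which are nonnegative if the function is.
    (This is where m_i <= 2 enters: a nonnegative function that is finally
    quadratic may well decrease at N.)  Splitting H in one direction after the
    other ([C_partial]) writes it as a finite sum of series
    t^c / prod_i (1 - t_i)^(e_i) with e_i <= m_i.  Each of them is the Hilbert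
    series of a shift of the quotient of R by all X_ij but the first e_i in
    each direction i ([realizable_npart]), and H is that of their direct sum
    ([realizableD]). *)

Set Implicit Arguments.
Unset Strict Implicit.
Unset Printing Implicit Defensive.

Import Order.TTheory GRing.Theory Num.Theory.
Local Open Scope ring_scope.

(** * Monomials and Dickson's lemma *)

Section Monomials.
Variable V : finType.
Implicit Types (u v w g : {cmonom V}) (x y : V).

Definition mk_mon (f : V -> nat) : {cmonom V} :=
  mkcmonom [fsfun y in [fset z in enum V]%fset => f y | 0%N].

Lemma mk_monE f x : mk_mon f x = f x.
Proof. by rewrite cmE fsfun_fun inE mem_enum. Qed.

Lemma monP u v : (forall x, u x = v x) -> u = v.
Proof. by move=> e; apply/eqP/cmP. Qed.

(** Induction on the list of variables that may occur.  For a new variable x,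
    the slices of U at the powers x^j increase with j, so their union is again
    closed under multiplication.  By induction that union is generated by
    monomials with bounded exponents; there are finitely many of these, so they
    all occur at one slice J0, from which on the slices are generated alike.
    The slices up to J0 have bounds of their own. *)
Lemma dickson (U : {cmonom V} -> Prop) :
  (forall u w, U u -> U (mmul w u)) ->
  exists N, forall u, U u ->
    exists g w, [/\ U g, u = mmul w g & forall x, (g x <= N)%N].
Proof.
move=> Uup.
suff: exists N, forall u, U u -> (forall x, x \notin enum V -> u x = 0%N) ->
    exists g w, [/\ U g, u = mmul w g & forall x, (g x <= N)%N].
  case=> N hN; exists N => u Uu; apply: hN => // x.
  by rewrite mem_enum.
elim: (enum V) => [|x l IH] in U Uup *.
  exists 0%N => u Uu u0; exists u, (mone : {cmonom V}); split => //.
    by rewrite mul1m.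
  by move=> x; rewrite u0.
(* xp j is the power x^j, and Us j is the slice of U at x^j. *)
pose xp j : {cmonom V} := mk_mon (fun y => if y == x then j else 0%N).
pose Us j u := U (mmul (xp j) u).
have xpD i j : xp (i + j)%N = mmul (xp i) (xp j).
  by apply: monP => y; rewrite cmM !mk_monE; case: eqP.
have Us_up j u w : Us j u -> Us j (mmul w u).
  by rewrite /Us mulmA [mmul (xp j) w]mulmC -mulmA; exact: Uup.
have Us_mono i j u : (i <= j)%N -> Us i u -> Us j u.
  by move=> /subnK <-; rewrite /Us xpD -mulmA; exact: Uup.
have [Ni hNi] := IH (fun u => exists j, Us j u)
  (fun u w => fun '(ex_intro j h) => ex_intro _ j (Us_up j u w h)).
have [Nf hNf] := choice (fun j => IH (Us j) (Us_up j)).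
(* J g is a slice that contains g, if there is one. *)
have /choice [J hJ] : forall g, exists j, (exists j, Us j g) -> Us j g.
  move=> g; have [[j h]|h] := pselect (exists j, Us j g); first by exists j.
  by exists 0%N => /h.
pose J0 := \max_(f : {ffun V -> 'I_Ni.+1}) J (mk_mon (fun x => f x)).
have J0P g : (exists j, Us j g) -> (forall y, (g y <= Ni)%N) -> Us J0 g.
  move=> /hJ h gN; apply: Us_mono h.
  pose f := [ffun y => inord (g y) : 'I_Ni.+1].
  rewrite (_ : g = mk_mon (fun x => f x)); first exact: leq_bigmax.
  by apply: monP => y; rewrite mk_monE ffunE inordK // ltnS.
exists (J0 + Ni + \sum_(j < J0.+1) Nf j)%N => u Uu u0.
pose u' := mk_mon (fun y => if y == x then 0%N else u y).
have uE : u = mmul (xp (u x)) u'.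
  by apply: monP => y; rewrite cmM !mk_monE; case: eqP => [->|]; rewrite ?addn0.
have u'0 y : y \notin l -> u' y = 0%N.
  rewrite mk_monE; case: eqP => // /eqP yx yl.
  by rewrite u0 // in_cons negb_or yx.
have Uu' : Us (u x) u' by rewrite /Us -uE.
have [le|lt] := leqP (u x) J0.
  have [g [w [Ug uw gN]]] := hNf _ _ Uu' u'0.
  exists (mmul (xp (u x)) g), w; split => //.
    by rewrite {1}uE uw !mulmA [mmul w _]mulmC.
  move=> y; rewrite cmM mk_monE.
  have : (Nf (u x) <= \sum_(j < J0.+1) Nf j)%N.
    by rewrite (bigD1 (Ordinal (le : u x < J0.+1)%N)) //= leq_addr.
  by have := gN y; case: ifP; lia.
have [g [w [Ug uw gN]]] := hNi u' (ex_intro (fun j => Us j u') (u x) Uu') u'0.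
exists (mmul (xp J0) g), (mmul (xp (u x - J0)%N) w); split.
- exact: J0P.
- rewrite {1}uE uw -{1}(subnK (ltnW lt)) xpD -!mulmA.
  by congr mmul; rewrite !mulmA (mulmC w).
- by move=> y; rewrite cmM mk_monE; have := gN y; case: ifP; lia.
Qed.

(** If u x >= N, a generator of U with exponents at most N that divides x u
    divides u as well. *)
Lemma upset_stable (U : {cmonom V} -> Prop) :
  (forall u w, U u -> U (mmul w u)) ->
  exists N, forall u x, (N <= u x)%N -> U (mmul (ucm x) u) -> U u.
Proof.
move=> Uup; have [N hN] := dickson Uup; exists N => u x Nx.
move=> /hN [g [w [Ug e gN]]].
have ey y : ((x == y) + u y = w y + g y)%N.
  by have := congr1 (fun z : {cmonom V} => z y) e; rewrite !cmM cmU.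
rewrite (_ : u = mmul (mk_mon (fun y => u y - g y)%N) g); first exact: Uup.
apply: monP => y; rewrite cmM mk_monE subnK //.
have := gN y; have := ey y; case: eqP => [<-|]; lia.
Qed.

End Monomials.

(** * Differences of functions on terms *)

Lemma mul_one_sub n (F : laurent n) i a :
  (F * (1 - tvar i)) a = F a - F (a - unit_vec i).
Proof. by rewrite mulrBr mulr1 mulrC; congr (_ - _); exact: lmonoM. Qed.

Section TermSums.
Variables (n : nat) (m : 'I_n -> nat) (T : finType) (d : T -> zdeg n).
Local Notation V := (var_index m).
Local Notation term := ({cmonom V} * T)%type.
Implicit Types (p q : term) (f g : term -> int) (x : V).

(** The pair (u, t) stands for the product of the monomial u and a generator
    indexed by t, of degree d t. *)
Definition term_deg p : zdeg n := mon_deg p.1 + d p.2.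

Lemma mon_degM (u v : {cmonom V}) : mon_deg (mmul u v) = mon_deg u + mon_deg v.
Proof.
apply/ffunP => i; rewrite !ffunE -big_split; apply: eq_bigr => j _.
by rewrite cmM PoszD.
Qed.

Lemma mon_degU x : mon_deg (ucm x) = unit_vec (tag x).
Proof.
(* The degree of a variable is read off from [homog_Xvar] over any field. *)
case: x => i j; have h := @homog_Xvar rat n m i j.
rewrite (h (ucm (Tagged (fun i => 'I_(m i)) j))) //.
by rewrite mcoeffU1 eqxx oner_neq0.
Qed.

Lemma le_mon_deg (u : {cmonom V}) x : (u x)%:Z <= mon_deg u (tag x).
Proof.
case: x => i j; rewrite ffunE (bigD1 j) //= lerDl.
by apply: sumr_ge0 => k _.
Qed.

Definition bounded_terms N : seq term :=
  undup [seq (mk_mon (fun x => f x), t) |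
           f : {ffun V -> 'I_N.+1} <- enum {ffun V -> 'I_N.+1}, t <- enum T].

Lemma mem_bounded_terms N p :
  (forall x, (p.1 x <= N)%N) -> p \in bounded_terms N.
Proof.
case: p => u t /= uN; rewrite mem_undup; apply/allpairsP.
exists ([ffun x => inord (u x)], t); rewrite !mem_enum; split => //=.
by congr pair; apply: monP => x; rewrite mk_monE ffunE inordK // ltnS.
Qed.

(** All terms of degree a: their exponents are bounded by the entries of
    a - d t, hence by the sum over t that is chosen here. *)
Definition fiber (a : zdeg n) : seq term :=
  [seq p <- bounded_terms (\sum_t \sum_i `|a i - d t i|%N) | term_deg p == a].

Lemma fiber_uniq a : uniq (fiber a).
Proof. by rewrite filter_uniq // undup_uniq. Qed.

Lemma mem_fiber a p : (p \in fiber a) = (term_deg p == a).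
Proof.
rewrite mem_filter; case: eqP => //= <-; apply: mem_bounded_terms => x.
have h : (p.1 x <= `|mon_deg p.1 (tag x)|)%N.
  by rewrite -lez_nat; apply: le_trans (le_mon_deg _ _) (ler_norm _).
apply: leq_trans h _; rewrite (bigD1 p.2) //= (bigD1 (tag x)) //=.
by rewrite !ffunE addrK -addnA leq_addr.
Qed.

Definition shift x p : term := (mmul (ucm x) p.1, p.2).

(** f p minus the value of f at p divided by x, which counts as 0 if x does not
    divide p. *)
Definition delta x f p : int :=
  f p - (if (0 < p.1 x)%N then f (divcm p.1 (ucm x), p.2) else 0).

Lemma shiftK x p : (divcm (shift x p).1 (ucm x), p.2) = p.
Proof.
case: p => u t; congr pair; apply: monP => y.
by rewrite divcmE cmM cmU addKn.
Qed.

Lemma divK x p : (0 < p.1 x)%N -> shift x (divcm p.1 (ucm x), p.2) = p.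
Proof.
case: p => u t /= h; congr pair; apply: monP => y.
by rewrite cmM divcmE cmU subnKC //; case: eqP => // <-.
Qed.

Lemma term_deg_shift x p : term_deg (shift x p) = unit_vec (tag x) + term_deg p.
Proof. by rewrite /term_deg mon_degM mon_degU addrA. Qed.

(** The shift by x is a bijection from the terms of degree a - e_i, where x is
    one of the X_ij, onto the terms of degree a that are divisible by x. *)
Lemma delta_fiber x f a :
  \sum_(p <- fiber a) delta x f p =
  \sum_(p <- fiber a) f p - \sum_(p <- fiber (a - unit_vec (tag x))) f p.
Proof.
rewrite sumrB; congr (_ - _); rewrite -big_mkcond /=.
rewrite -[RHS](eq_bigr _ (fun p _ => congr1 f (shiftK x p))).
rewrite -(big_map (shift x) xpredT (fun p => f (divcm p.1 (ucm x), p.2))).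
rewrite -big_filter; apply: perm_big; apply: uniq_perm.
- by rewrite filter_uniq // fiber_uniq.
- rewrite map_inj_uniq ?fiber_uniq // => p q e.
  by rewrite -[p](shiftK x) -[q](shiftK x) e; case: p q e => ? ? [? ?] [_ ->].
move=> p; rewrite mem_filter mem_fiber; apply/idP/mapP.
  case/andP => px /eqP pa; exists (divcm p.1 (ucm x), p.2); last by rewrite divK.
  rewrite mem_fiber -pa; set q := (_, _).
  by rewrite -(divK px) -/q term_deg_shift addrC addKr.
case=> q; rewrite mem_fiber => /eqP qa ->.
by rewrite term_deg_shift qa addrC subrK eqxx cmM cmUU.
Qed.

Definition deltas (l : seq V) f := foldr delta f l.

Lemma fiber_sum_mul (F : laurent n) f (l : seq V) :
  (forall a, F a = \sum_(p <- fiber a) f p) ->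
  forall a, (F * \prod_(x <- l) (1 - tvar (tag x))) a =
    \sum_(p <- fiber a) deltas l f p.
Proof.
move=> Ff; elim: l => [|x l IH] a; first by rewrite big_nil mulr1.
rewrite big_cons [deltas _ _]/= delta_fiber -!IH -mul_one_sub.
by rewrite -mulrA [_ * (1 - _)]mulrC.
Qed.

Lemma prod_vars : \prod_(x <- enum {: V}) (1 - tvar (tag x)) =
  \prod_(i < n) (1 - tvar i) ^+ m i :> laurent n.
Proof.
rewrite big_enum /=.
rewrite (eq_bigr (fun i => \prod_(j < m i) (1 - tvar i))); last first.
  by move=> i _; rewrite prodr_const card_ord.
by rewrite sig_big_dep.
Qed.

Definition stable N x f := forall p, (N <= p.1 x)%N -> f (shift x p) = f p.
Definition dies N x f := forall p, (N < p.1 x)%N -> f p = 0.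

Lemma shift_div x y p : x != y ->
  (divcm (shift x p).1 (ucm y), p.2) = shift x (divcm p.1 (ucm y), p.2).
Proof.
move=> xy; congr pair; apply: monP => z; rewrite !(divcmE, cmM) !cmU.
by case: (eqVneq y z) => [<-|]; rewrite ?(negbTE xy) ?subn0.
Qed.

Lemma delta_stable N x y f : x != y -> stable N x f -> stable N x (delta y f).
Proof.
move=> xy fs p px; rewrite /delta fs //; congr (_ - _).
rewrite cmM cmU (negbTE xy) add0n; case: ifP => // py.
by rewrite shift_div // fs //= divcmE cmU eq_sym (negbTE xy) subn0.
Qed.

Lemma delta_dies N x y f : x != y -> dies N x f -> dies N x (delta y f).
Proof.
move=> xy fd p px; rewrite /delta fd // sub0r; case: ifP => // py.
by rewrite fd ?oppr0 //= divcmE cmU eq_sym (negbTE xy) subn0.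
Qed.

Lemma stable_delta_dies N x f : stable N x f -> dies N x (delta x f).
Proof.
move=> fs p px; rewrite /delta (leq_ltn_trans _ px) //.
rewrite -{1}(@divK x p) ?fs ?subrr //; last by rewrite (leq_ltn_trans _ px).
by rewrite /= divcmE cmUU; lia.
Qed.

(** Differences in other directions respect both properties, so the difference
    in direction x turns stability into vanishing no matter when it is taken. *)
Lemma deltas_dies N x (l : seq V) f : uniq l ->
  stable N x f ->
  if x \in l then dies N x (deltas l f) else stable N x (deltas l f).
Proof.
move=> + fs; elim: l => //= y l IH /andP [yl /IH{}IH].
rewrite in_cons; have [xy|xy] /= := eqVneq x y.
  by move: IH; rewrite xy (negbTE yl) => /stable_delta_dies.
by case: ifP IH => xl IH; [apply: delta_dies|apply: delta_stable].
Qed.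

(** The iterated difference of f lives on the terms with all exponents at most
    N, and these have finitely many degrees. *)
Lemma fiber_sum_laurent_poly (F : laurent n) f N :
  (forall a, F a = \sum_(p <- fiber a) f p) -> (forall x, stable N x f) ->
  is_laurent_poly (F * \prod_(i < n) (1 - tvar i) ^+ m i).
Proof.
move=> Ff fs; rewrite -prod_vars.
apply: (@sub_finite_set _ _ (term_deg @` [set` bounded_terms N])%classic);
  last first.
  by apply: finite_image; exact: finite_seq.
move=> a nz0.
have {nz0} nz : \sum_(p <- fiber a) deltas (enum {: V}) f p != 0.
  by rewrite -(fiber_sum_mul _ Ff).
have [p pa fp] : exists2 p, p \in fiber a & deltas (enum {: V}) f p != 0.
  apply: contrapT => h; case/eqP: nz; rewrite big_seq big1 // => p pa.
  by apply: contrapT => /eqP fp; apply: h; exists p.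
exists p; last by move: pa; rewrite mem_fiber => /eqP.
apply: mem_bounded_terms => x; rewrite leqNgt; apply/negP => px.
have xV : x \in enum {: V} by rewrite mem_enum.
have := deltas_dies (enum_uniq {: V}) (fs x); rewrite xV => /(_ p px).
exact/eqP.
Qed.

End TermSums.

(** * Homogeneous components *)

Lemma sum_by_degree (M : nmodType) (D : eqType) (I : Type) (r : seq I)
    (z : I -> M) (deg : I -> D) (s : seq D) :
  uniq s -> all (fun i => deg i \in s) r ->
  \sum_(i <- r) z i = \sum_(a <- s) \sum_(i <- r | deg i == a) z i.
Proof.
move=> s_uniq; elim: r => [|j r IH] /=.
  by rewrite big_nil big1 // => a _; rewrite big_nil.
case/andP=> js /IH{}IH; rewrite big_cons IH.
under [RHS]eq_bigr do rewrite big_cons.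
rewrite (bigD1_seq (deg j)) //= [in RHS](bigD1_seq (deg j)) //= eqxx.
rewrite addrA; congr (_ + _); apply: eq_bigr => a.
by rewrite eq_sym => /negbTE ->.
Qed.

Section Components.
Variables (K : fieldType) (n : nat) (m : 'I_n -> nat).
Variables (M : lmodType (gpoly K m)) (gr : grading M).

Lemma pieceD a x y : gr a x -> gr a y -> gr a (x + y).
Proof.
move=> gx gy; rewrite -[y]opprK; apply: pieceB => //.
by rewrite -sub0r; apply: pieceB => //; exact: piece0.
Qed.

Lemma piece_bigsum a (I : Type) (r : seq I) (P : pred I) (z : I -> M) :
  (forall i, P i -> gr a (z i)) -> gr a (\sum_(i <- r | P i) z i).
Proof.
by move=> h; apply: (big_ind (gr a)) => //; [exact: piece0|exact: pieceD].
Qed.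

(** Group the summands by degree and subtract x from the group of degree a: the
    result is a sum of homogeneous elements equal to 0. *)
Lemma homog_component (I : Type) (r : seq I) (z : I -> M)
    (deg : I -> zdeg n) a x :
  (forall i, gr (deg i) (z i)) -> gr a x -> x = \sum_(i <- r) z i ->
  x = \sum_(i <- r | deg i == a) z i.
Proof.
move=> zdeg xa xE.
pose y b := (\sum_(i <- r | deg i == b) z i) - (if b == a then x else 0).
pose s := undup (a :: map deg r).
have as_ : a \in s by rewrite mem_undup mem_head.
have su : uniq s by exact: undup_uniq.
apply/esym/subr0_eq; have -> : \sum_(i <- r | deg i == a) z i - x = y a.
  by rewrite /y eqxx.
apply: (piece_direct (g := gr) su) as_ => [b|].
  apply: pieceB; first by apply: piece_bigsum => i /eqP <-.
  by case: eqP => [->|_]; [|exact: piece0].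
rewrite sumrB -sum_by_degree //; last first.
  have := allss (map deg r); rewrite all_map; apply: sub_all => i /=.
  by rewrite mem_undup in_cons orbC => ->.
rewrite -big_mkcond -big_filter filter_pred1_uniq // ?mem_undup ?mem_head //.
by rewrite big_cons big_nil /= addr0 -xE subrr.
Qed.

(** The homogeneous components of finitely many generators. *)
Lemma homog_generators : fin_gen M ->
  exists (T : finType) (d : T -> zdeg n) (g : T -> M),
    (forall t, gr (d t) (g t)) /\
    (forall x, exists c : T -> gpoly K m, x = \sum_t c t *: g t).
Proof.
case=> r [g0 g0E].
have [s s_P] := choice (fun i => piece_sum gr (g0 i)).
have {s_P} [y s_P] := choice s_P.
exists {k : 'I_r & 'I_(size (s k))}.
pose dt (t : {k : 'I_r & 'I_(size (s k))}) : zdeg n :=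
  nth 0 (s (tag t)) (tagged t : 'I_(size (s (tag t)))).
exists dt, (fun t => y (tag t) (dt t)).
split=> [t|x]; first by case: (s_P (tag t)).
have [c ->] := g0E x; exists (fun t => c (tag t)).
pose P (k : 'I_r) (l : 'I_(size (s k))) := y k (nth 0 (s k) l).
transitivity (\sum_(k < r) \sum_(l < size (s k)) c k *: P k l); last first.
  by rewrite sig_big_dep.
apply: eq_bigr => k _; rewrite -scaler_sumr; congr (_ *: _).
by case: (s_P k) => _ {1}->; rewrite (big_nth 0) big_mkord.
Qed.

Lemma homogU (u : {cmonom var_index m}) (c : K) : homog (mon_deg u) << c *g u >>.
Proof.
by move=> v; rewrite mcoeffU; case: (u =P v) => [->|]; rewrite ?mulr0n ?eqxx.
Qed.

End Components.

(** * The rank of a list of rows *)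

Section RankByRows.
Variables (K : fieldType) (d : nat) (I : eqType) (lt : rel I) (v : I -> 'rV[K]_d).
Hypotheses (lt_irr : irreflexive lt) (lt_trans : transitive lt).

Lemma rank_addsmx_row (A : 'M[K]_d) (r : 'rV[K]_d) :
  \rank (A + r)%MS = (\rank A + ~~ (r <= A)%MS)%N.
Proof.
have [rA|rA] /= := boolP (r <= A)%MS.
  by rewrite addn0 (addsmx_idPl rA).
apply/eqP; rewrite eqn_leq; apply/andP; split.
  apply: leq_trans (mxrank_adds_leqif _ _) _.
  by rewrite leq_add2l rank_leq_row.
by rewrite addn1 rank_ltmx // ltmxE addsmxSl addsmx_sub submx_refl.
Qed.

(** A row raises the rank exactly if it is not in the span of its
    predecessors; so the rank counts the rows that a greedy choice of a basis
    keeps. *)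
Lemma rank_sorted (s : seq I) : sorted lt s ->
  \rank (\sum_(i <- s) <<v i>>)%MS =
  count (fun i => ~~ (v i <= \sum_(j <- s | lt j i) <<v j>>)%MS) s.
Proof.
rewrite sorted_pairwise //.
elim/last_ind: s => [|s i IH]; first by rewrite big_nil mxrank0.
rewrite pairwise_rcons => /andP [/allP si ss].
rewrite -cats1 big_cat big_seq1 count_cat /= addn0.
rewrite (adds_eqmx (eqmx_refl _) (genmxE (v i))) rank_addsmx_row.
have iF j : j \in s -> lt i j = false.
  by move=> /si h; apply/negP => /(lt_trans h); rewrite lt_irr.
congr (_ + _)%N.
  rewrite IH //; apply: eq_in_count => j js.
  by rewrite big_cat /= [X in (_ + X)%MS]big_mkcond big_seq1 iF // addsmx0.
rewrite big_cat /= [X in (_ + X)%MS]big_mkcond big_seq1 lt_irr addsmx0.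
rewrite [in RHS]big_seq_cond [in LHS]big_seq_cond.
congr (nat_of_bool (~~ (_ <= _)%MS)); apply: eq_bigl => j.
by rewrite andbT andb_idr // => /si.
Qed.
End RankByRows.

(** * A term order *)

Section TermOrder.
Variables (V T : finType).
Local Notation term := ({cmonom V} * T)%type.
Implicit Types (p q : term) (w : {cmonom V}).

(** Terms are compared lexicographically, first by the index of the generator
    and then by the exponents. *)
Definition term_key p : seqlexi nat :=
  (enum_rank p.2 : nat) :: [seq p.1 x | x <- enum V].

Definition term_lt p q : bool := (term_key p < term_key q)%O.

Definition term_mul w p : term := (mmul w p.1, p.2).

Lemma term_key_inj : injective term_key.
Proof.
move=> [u s] [v t] [/ord_inj/enum_rank_inj /= -> uv]; congr pair.
by move/eq_in_map: uv => uv; apply: monP => x; apply: uv; rewrite mem_enum.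
Qed.

Lemma term_lt_mul w p q : term_lt (term_mul w p) (term_mul w q) = term_lt p q.
Proof.
rewrite /term_lt /term_key !ltxi_cons /=; congr (_ && (_ ==> _)).
elim: (enum V) => //= x l IH.
by rewrite !ltxi_cons !cmM !leEnat !leq_add2l IH.
Qed.

Lemma term_lt_irr : irreflexive term_lt.
Proof. by move=> p; exact: ltxx. Qed.

Lemma term_lt_trans : transitive term_lt.
Proof. by move=> p q r; exact: lt_trans. Qed.

Definition term_sort (s : seq term) :=
  sort (fun p q => term_key p <= term_key q)%O s.

Lemma term_sort_sorted s : uniq s -> sorted term_lt (term_sort s).
Proof.
move=> us; change (sorted (relpre term_key <%O%O) (term_sort s)).
rewrite -sorted_map lt_sorted_uniq_le.
rewrite map_inj_uniq ?sort_uniq ?us /=; last exact: term_key_inj.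
by rewrite sorted_map; apply: sort_sorted => p q; exact: le_total.
Qed.

End TermOrder.

(** * Standard terms and the Hilbert series *)

Section MonomialAlgebra.
Variables (K : fieldType) (V : choiceType).
Implicit Types (u v : {cmonom V}) (c : K).

Lemma monU_mul u v : << u >> * << v >> = << mmul u v >> :> {malg K[{cmonom V}]}.
Proof. by rewrite malgM_def fgmulUU mulr1. Qed.

Lemma monU_scale c u : << c *g u >> = c *: << u >> :> {malg K[{cmonom V}]}.
Proof. by rewrite -mul_malgC malgM_def fgmulUU mulr1 mul1m. Qed.

Lemma malg_expand (p : {malg K[{cmonom V}]}) :
  p = \sum_(u <- msupp p) p@_u *: << u >>.
Proof. by rewrite {1}(monalgE p); apply: eq_bigr => u _; rewrite monU_scale. Qed.

End MonomialAlgebra.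

(** Scalars of K act on modules over a K-algebra A through the elements
    c%:A. *)
Section AlgScale.
Variables (K : fieldType) (A : comAlgType K) (M : lmodType A).
Implicit Types (c k : K) (a b : A) (x : M).

Lemma alg_scaleCA a c x : a *: (c%:A *: x) = c%:A *: (a *: x).
Proof. by rewrite !scalerA mulrC. Qed.

Lemma alg_scaleM a b x : a *: (b *: x) = (a * b) *: x.
Proof. exact: scalerA. Qed.

Lemma alg_scaleA c k x : (c * k)%:A *: x = c%:A *: (k%:A *: x).
Proof. by rewrite [RHS]scalerA -scalerAl mul1r scalerA. Qed.

Lemma alg_scaleDl c k x : (c + k)%:A *: x = c%:A *: x + k%:A *: x.
Proof. by rewrite scalerDl scalerDl. Qed.

Lemma alg_scale0 x : (0%:A : A) *: x = 0.
Proof. by rewrite scale0r scale0r. Qed.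

Lemma alg_scale1 x : (1%:A : A) *: x = x.
Proof. by rewrite scale1r scale1r. Qed.

Lemma alg_scaler c a x : (c *: a) *: x = c%:A *: (a *: x).
Proof. by rewrite scalerA -scalerAl mul1r. Qed.

End AlgScale.

Section StandardTerms.
Variables (K : fieldType) (n : nat) (m : 'I_n -> nat).
Variables (M : lmodType (gpoly K m)) (gr : grading M).
Variables (T : finType) (d : T -> zdeg n) (g : T -> M).
Hypothesis g_deg : forall t, gr (d t) (g t).
Hypothesis g_gen : forall x, exists c : T -> gpoly K m, x = \sum_t c t *: g t.
Local Notation V := (var_index m).
Local Notation term := ({cmonom V} * T)%type.
Implicit Types (p : term) (P : term -> Prop) (w : {cmonom V}) (c : K).

Definition term_val p : M := << p.1 >> *: g p.2.

Lemma term_val_deg p : gr (term_deg d p) (term_val p).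
Proof. by apply: pieceZ (g_deg _); exact: homogU. Qed.

Lemma term_valM w p : term_val (term_mul w p) = << w >> *: term_val p.
Proof. by rewrite /term_val -(monU_mul K w p.1) -alg_scaleM. Qed.

(** The K-span of the values of the terms in P.  A list of pairs allows a term
    to be repeated, so that multiplying by a monomial maps combinations to
    combinations. *)
Definition term_span P (x : M) := exists s : seq (K * term),
  (forall q, q \in s -> P q.2) /\ x = \sum_(q <- s) q.1%:A *: term_val q.2.

Definition nonstd p :=
  term_span (fun q => term_deg d q = term_deg d p /\ term_lt q p) (term_val p).

(** Multiply the combination of smaller terms by w; the order of terms and
    equality of degrees are invariant under multiplication by w. *)
Lemma nonstd_mul w p : nonstd p -> nonstd (term_mul w p).
Proof.
case=> s [sP pE].
exists [seq (q.1, term_mul w q.2) | q <- s : seq (K * term)]; split.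
  move=> _ /mapP [q /sP [qd qp] ->] /=; split; last by rewrite term_lt_mul.
  by move: qd; rewrite /term_deg /= !mon_degM -!addrA => ->.
rewrite term_valM pE scaler_sumr big_map; apply: eq_bigr => q _.
by rewrite (term_valM w q.2); exact: alg_scaleCA.
Qed.

(** Expand x in the generators and keep the terms of degree a. *)
Lemma piece_term_span a x : gr a x -> term_span (fun q => term_deg d q = a) x.
Proof.
move=> xa; have [c xE] := g_gen x.
pose r := [seq ((c t)@_u, (u, t)) | t <- enum T, u <- msupp (c t)].
exists [seq q <- r | term_deg d q.2 == a]; split.
  by move=> q; rewrite mem_filter => /andP [/eqP].
rewrite big_filter.
apply: (homog_component (deg := fun q : K * term => term_deg d q.2)) xa _.
  move=> q; rewrite -[term_deg _ _]add0r; apply: pieceZ (term_val_deg _).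
  move=> u; rewrite mcoeffZ mcoeff1.
  case: (u =P mone) => [->|]; last by rewrite mulr0 eqxx.
  by move=> _; apply/ffunP => i; rewrite !ffunE big1 // => j _; rewrite cm1.
rewrite big_allpairs_dep /= big_enum /= xE; apply: eq_bigr => t _.
rewrite {1}(malg_expand (c t)) scaler_suml; apply: eq_bigr => u _.
exact: alg_scaler.
Qed.

Section OneDegree.
Variables (a : zdeg n) (D : nat) (e : 'I_D -> M).
Hypothesis e_basis : is_Kbasis (gr a) e.

Definition of_coords (r : 'rV[K]_D) : M := \sum_i (r 0 i)%:A *: e i.

Lemma of_coordsD r s : of_coords (r + s) = of_coords r + of_coords s.
Proof.
rewrite /of_coords -big_split; apply: eq_bigr => i _.
by rewrite mxE; exact: alg_scaleDl.
Qed.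

Lemma of_coordsZ c r : of_coords (c *: r) = c%:A *: of_coords r.
Proof.
rewrite [RHS]scaler_sumr; apply: eq_bigr => i _.
by rewrite mxE; exact: alg_scaleA.
Qed.

Lemma of_coords_sum (I : Type) (s : seq I) (f : I -> 'rV[K]_D) :
  of_coords (\sum_(i <- s) f i) = \sum_(i <- s) of_coords (f i).
Proof.
apply: (big_morph of_coords of_coordsD).
by rewrite /of_coords big1 // => i _; rewrite mxE; exact: alg_scale0.
Qed.

Lemma of_coords_inj : injective of_coords.
Proof.
move=> r s rs; apply/rowP => i; apply/subr0_eq.
case: e_basis => _ e_free _.
have : of_coords (r - s) = 0.
  by rewrite of_coordsD rs -of_coordsD subrr -(scale0r 0) of_coordsZ alg_scale0.
by move/e_free => /(_ i); rewrite !mxE.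
Qed.

Lemma of_coords_delta i : of_coords (delta_mx 0 i) = e i.
Proof.
rewrite /of_coords (bigD1 i) // big1 => [|j ji]; last first.
  by rewrite mxE (negbTE ji) andbF; exact: alg_scale0.
by apply: (etrans (addr0 _)); rewrite mxE !eqxx; exact: alg_scale1.
Qed.

Variable v : term -> 'rV[K]_D.
Hypothesis v_val : forall p, term_deg d p = a -> of_coords (v p) = term_val p.

(** Coordinates in the basis e turn spans of terms of degree a into row
    spaces. *)
Lemma term_span_coords (F : seq term) (Q : pred term) r :
  (forall p, p \in F <-> term_deg d p = a) ->
  term_span (fun q => term_deg d q = a /\ Q q) (of_coords r) <->
  (r <= \sum_(q <- F | Q q) <<v q>>)%MS.
Proof.
move=> F_P; split.
  case=> s [sP rE].
  have -> : r = \sum_(q <- s) q.1 *: v q.2.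
    apply: of_coords_inj; rewrite rE of_coords_sum big_seq [RHS]big_seq.
    by apply: eq_bigr => q /sP [qa _]; rewrite of_coordsZ v_val.
  rewrite big_seq; apply: summx_sub => q /sP [/F_P qF qQ].
  apply: scalemx_sub; rewrite (big_rem _ qF) /= qQ.
  by apply: submx_trans (addsmxSl _ _); rewrite genmxE.
have {F_P} : forall p, p \in F -> term_deg d p = a by move=> p /F_P.
elim: F => [|p F IH] in r *.
  rewrite big_nil submx0 => _ /eqP ->; exists [::]; split => //.
  by rewrite big_nil -(scale0r 0) of_coordsZ alg_scale0.
move=> F_P; have {}IH := IH ^~ (fun q qF => F_P q (mem_behead (s := p :: F) qF)).
rewrite big_cons; case: ifP => Qp; last exact: IH.
case/sub_addsmxP=> -[r1 r2] /= rE.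
have /sub_rVP [c cE] : (r1 *m <<v p>>%MS <= v p)%MS.
  by apply: submx_trans (submxMl _ _) _; rewrite genmxE.
have [s [sP sE]] := IH _ (submxMl r2 (\sum_(q <- F | Q q) <<v q>>)%MS).
exists ((c, p) :: s); split.
  move=> q; rewrite in_cons => /orP [/eqP ->|/sP //].
  by split=> //; rewrite F_P ?mem_head.
by rewrite big_cons rE of_coordsD -sE cE of_coordsZ v_val // F_P ?mem_head.
Qed.

End OneDegree.

(** D is the rank of the coordinate rows of the sorted terms of degree a, which
    span everything; a row lies in the span of its predecessors exactly if its
    term is nonstandard. *)
Lemma count_standard a D : Kdim (gr a) D ->
  D = count (fun p => ~~ `[< nonstd p >]) (fiber m d a).
Proof.
case=> e e_basis; case: (e_basis) => e_in _ e_span.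
have /choice [v v_val] : forall p, exists r : 'rV[K]_D,
    term_deg d p = a -> of_coords e r = term_val p.
  move=> p; have [pa|] := pselect (term_deg d p = a); last by exists 0.
  have := term_val_deg p; rewrite pa => /e_span [c cE].
  exists (\row_i c i) => _; rewrite cE.
  by apply: eq_bigr => i _; rewrite mxE.
pose F := term_sort (fiber m d a).
have F_P p : p \in F <-> term_deg d p = a.
  by rewrite mem_sort mem_fiber; split=> /eqP.
have rankF : \rank (\sum_(p <- F) <<v p>>)%MS = D.
  apply/eqP; rewrite eqn_leq rank_leq_row -{1}(mxrank1 K D) mxrankS //.
  apply/row_subP => i; rewrite row1.
  apply/(term_span_coords e_basis v_val xpredT _ F_P).
  have [s [sP sE]] := piece_term_span (e_in i).
  by exists s; split; [move=> q /sP|rewrite of_coords_delta].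
rewrite -{1}rankF (rank_sorted (lt := @term_lt _ _)).
- rewrite -(count_sort (fun p q => term_key p <= term_key q)%O).
  apply: eq_in_count => p /F_P pa; congr negb.
  apply/idP/asboolP.
    move=> /(term_span_coords e_basis v_val (fun q => term_lt q p) _ F_P).
    by rewrite v_val // /nonstd pa.
  move=> ns; apply/(term_span_coords e_basis v_val (fun q => term_lt q p) _ F_P).
  by rewrite v_val // -pa.
- exact: term_lt_irr.
- exact: term_lt_trans.
- exact/term_sort_sorted/fiber_uniq.
Qed.

End StandardTerms.

(** For each generator t, the monomials u with (u, t) nonstandard are closed
    under multiplication; the sum of the bounds for the individual t serves all
    of them. *)
Lemma hilbert_series_laurent_poly (K : fieldType) (n : nat) (m : 'I_n -> nat)
    (M : lmodType (gpoly K m)) (gr : grading M) (H : laurent n) :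
  fin_gen M -> is_hilbert_series gr H ->
  is_laurent_poly (H * \prod_(i < n) (1 - tvar i) ^+ m i).
Proof.
move=> /(homog_generators gr) [T [d [g [g_deg g_gen]]]] gH.
have [Nf Nf_P] := choice (fun t => upset_stable
  (fun u w => @nonstd_mul K n m M T d g w (u, t))).
apply: (@fiber_sum_laurent_poly n m T d H
  (fun p => (~~ `[< nonstd d g p >] : nat)%:Z) (\sum_t Nf t)).
  move=> a; have [D /(count_standard g_deg g_gen) DE ->] := gH a.
  rewrite {1}DE; elim: (fiber m d a) => [|p s IH]; rewrite ?big_nil //.
  by rewrite big_cons -IH PoszD.
move=> x [u t] Nu.
have E : nonstd d g (term_mul (ucm x) (u, t)) <-> nonstd d g (u, t).
  split; last exact: nonstd_mul.
  by apply: Nf_P; apply: leq_trans Nu; rewrite (bigD1 t) // leq_addr.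
exact: (congr1 (fun b : bool => (~~ b : nat)%:Z) (asbool_equiv_eq E)).
Qed.

(** * Growth of a series in one direction *)

(** For k <= 2, the number of ways of writing b as a sum of k naturals; as a
    function of b it is the point mass at 0, the step function of [0, +oo) or
    the ramp that takes the value 1 at 0. *)
Definition npart (k : nat) (b : int) : nat :=
  match k with
  | 0 => nat_of_bool (b == 0%R)
  | 1 => nat_of_bool (0 <= b)%R
  | _ => if (0 <= b)%R then `|b|.+1 else 0
  end.

Section Eventually.
Variable n : nat.
Implicit Types (F G H : laurent n) (a b : zdeg n) (i j : 'I_n) (N L x : int).

Definition upd a i x : zdeg n := [ffun k => if k == i then x else a k].

Lemma updE a i x : upd a i x i = x.
Proof. by rewrite ffunE eqxx. Qed.

Lemma upd_id a i : upd a i (a i) = a.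
Proof. by apply/ffunP => k; rewrite ffunE; case: eqP => [->|]. Qed.

Lemma updC a i j x y : i != j -> upd (upd a i x) j y = upd (upd a j y) i x.
Proof.
move=> ij; apply/ffunP => k; rewrite !ffunE.
by case: (k =P j) => // ->; rewrite eq_sym (negbTE ij).
Qed.

Lemma upd_sub_unit a i x : upd a i x - unit_vec i = upd a i (x - 1).
Proof. by apply/ffunP => k; rewrite !ffunE; case: eqP => //= _; rewrite subr0. Qed.

Definition vanishes i N F := forall a, N <= a i -> F a = 0.

(** F is constant along direction j where F (1 - t_j) vanishes, and F is 0 far
    down in direction j; moving there does not change the entry i. *)
Lemma vanishes_cancel i j N F : i != j ->
  vanishes i N (F * (1 - tvar j)) -> vanishes i N F.
Proof.
move=> ij FN a ai; have [b Fb] := lbounded F.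
have step k : F a = F (upd a j (a j - k%:Z)).
  elim: k => [|k IH]; first by rewrite subr0 upd_id.
  have := FN (upd a j (a j - k%:Z)); rewrite ffunE (negbTE ij) => /(_ ai).
  rewrite mul_one_sub upd_sub_unit => /subr0_eq e.
  by rewrite IH e; congr (F (upd _ _ _)); lia.
rewrite (step (`|a j - b j|.+1)%N) Fb // => /(_ j).
by rewrite updE; lia.
Qed.

Lemma vanishes_prod i N F (m : 'I_n -> nat) (l : seq 'I_n) : i \notin l ->
  vanishes i N (F * \prod_(j <- l) (1 - tvar j) ^+ m j) -> vanishes i N F.
Proof.
elim: l => [|j l IH]; first by rewrite big_nil mulr1.
rewrite in_cons negb_or big_cons => /andP [ij il].
rewrite mulrCA mulrC; elim: (m j) => [|k IHk]; first by rewrite mulr1; exact: IH.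
by rewrite exprSr mulrA => /(vanishes_cancel ij).
Qed.

Variable m : 'I_n -> nat.
Hypothesis m_le2 : forall i, (m i <= 2)%N.

(** In direction i the function G is 0 below L; from N on it is 0, constant or
    affine according to m i = 0, 1, 2. *)
Definition tame L N i (G : zdeg n -> int) :=
  (forall a, a i < L -> G a = 0) /\
  (forall a (k : nat), G (upd a i (N + k%:Z)) =
     (0 < m i)%:R * G (upd a i N) +
     (1 < m i)%:R * (k%:Z * (G (upd a i (N + 1)) - G (upd a i N)))).

(** Beyond the support of the Laurent polynomial in direction i, the product of
    H with the power of 1 - t_i alone vanishes by [vanishes_prod]; this is a
    recursion of order m i for H in that direction. *)
Lemma laurent_poly_tame H :
  is_laurent_poly (H * \prod_(i < n) (1 - tvar i) ^+ m i) ->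
  exists L N, L <= N /\ forall i, tame L N i H.
Proof.
case/finite_seqP=> s s_P.
pose N := (\sum_(a <- s) \sum_i `|a i|).+1; have [b Hb] := lbounded H.
exists (- (\sum_i `|b i|)%:Z), N%:Z; split=> [|i]; first by lia.
split=> [a ai|].
  rewrite Hb // => /(_ i); move: ai; rewrite (bigD1 i) //=; lia.
have HN : vanishes i N%:Z (H * (1 - tvar i) ^+ m i).
  apply: (@vanishes_prod i N%:Z _ m (rem i (enum 'I_n))).
    by rewrite mem_rem_uniqF // enum_uniq.
  move=> a ai; rewrite -mulrA.
  have <- : \prod_(j < n) (1 - tvar j) ^+ m j = (1 - tvar i) ^+ m i *
      \prod_(j <- rem i (enum 'I_n)) (1 - tvar j) ^+ m j :> laurent n.
    by rewrite -big_enum (big_rem i) ?mem_enum.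
  apply: contrapT => /eqP nz.
  have as_ : a \in s by change ([set` s]%classic a); rewrite -s_P.
  by move: ai; rewrite /N (big_rem _ as_) /= (bigD1 i) //=; lia.
have := m_le2 i; case: (m i) HN => [|[|[]]] //= HN _ a k.
- rewrite !mul0r addr0; have := HN (upd a i (N%:Z + k%:Z)).
  by rewrite mulr1 updE; apply; lia.
- rewrite mul1r mul0r addr0; elim: k => [|k IH]; first by rewrite addr0.
  have := HN (upd a i (N%:Z + k.+1%:Z)); rewrite updE mul_one_sub upd_sub_unit.
  move=> /(_ ltac:(lia)) /subr0_eq ->; rewrite -IH; congr (H (upd _ _ _)); lia.
- rewrite !mul1r.
  (* H (1 - t_i)^2 vanishes beyond N, so the increments of H are constant. *)
  pose D k := H (upd a i (N%:Z + k.+1%:Z)) - H (upd a i (N%:Z + k%:Z)).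
  have DS k' : D k'.+1 = D k'.
    have := HN (upd a i (N%:Z + k'.+2%:Z)).
    rewrite updE expr2 mulrA !mul_one_sub !upd_sub_unit.
    move=> /(_ ltac:(lia)) /subr0_eq.
    rewrite /D.
    have -> : N%:Z + k'.+2%:Z - 1 = N%:Z + k'.+1%:Z by lia.
    by have -> : N%:Z + k'.+1%:Z - 1 = N%:Z + k'%:Z by lia.
  have Dk k' : D k' = D 0%N by elim: k' => // k' <-.
  elim: k => [|k IH]; first by rewrite addr0 mul0r addr0.
  have := Dk k; rewrite {1}/D IH /D addr0.
  set A := H (upd a i (N%:Z + k.+1%:Z)); set B := H (upd a i N%:Z).
  have -> : 1%:Z = 1 by [].
  set C := H _ => e; lia.
Qed.

(** An affine function that is nonnegative on a half-line has slope at least 0. *)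
Lemma tame_nonneg_step L N i (G : zdeg n -> int) a : tame L N i G -> m i = 2%N ->
  (forall b, 0 <= G b) -> 0 <= G (upd a i (N + 1)) - G (upd a i N).
Proof.
move=> [_ tG] mi G0; rewrite leNgt; apply/negP => neg.
(* With negative slope, G would be negative after |G (upd a i N)| + 1 steps. *)
have := G0 (upd a i (N + `|G (upd a i N)|.+1%:Z)).
rewrite tG mi !mul1r; have := G0 (upd a i N).
move: neg; set D := G _ - _; set A := G _ => neg A0.
have : (`|A|.+1)%:Z * D <= (`|A|.+1)%:Z * -1 by rewrite ler_wpM2l //; lia.
lia.
Qed.

Lemma tame_upd L N i j x (G : zdeg n -> int) : i != j ->
  tame L N j G -> tame L N j (fun b => G (upd b i x)).
Proof.
move=> ij [t1 t2]; split=> [a aj|a k].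
  by apply: t1; rewrite ffunE eq_sym (negbTE ij).
by rewrite !(@updC _ j i) ?(eq_sym j) // t2.
Qed.

Lemma tameB L N j (G G' : zdeg n -> int) :
  tame L N j G -> tame L N j G' -> tame L N j (fun b => G b - G' b).
Proof.
move=> [t1 t2] [t1' t2']; split=> [a aj|a k]; first by rewrite t1 ?t1' // subrr.
rewrite t2 t2'; ring.
Qed.

(** Point masses below N, a step function at N and a ramp that starts at N + 1:
    at N the step alone must give the value of G. *)
Lemma tame_expand L N i (G : zdeg n -> int) b x : L <= N -> tame L N i G ->
  G (upd b i x) =
    \sum_(k < `|N - L|) (npart 0 (x - (L + k%:Z)))%:Z * G (upd b i (L + k%:Z)) +
    (0 < m i)%:R * ((npart 1 (x - N))%:Z * G (upd b i N)) +
    (1 < m i)%:R * ((npart 2 (x - (N + 1)))%:Z *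
                    (G (upd b i (N + 1)) - G (upd b i N))).
Proof.
move=> LN [t1 t2]; have [Nx|xN] := leP N x.
  rewrite big1 => [|k _]; last first.
    rewrite /npart; case: eqP => [e|]; rewrite ?mul0r //.
    by have := ltn_ord k; lia.
  have -> : x = N + `|x - N|%:Z by lia.
  rewrite t2 add0r; congr (_ + _ * _).
    by rewrite /npart; case: leP => //; [rewrite mul1r|lia].
  by congr (_ * _); rewrite /npart; case: leP; lia.
have -> : (npart 1 (x - N))%:Z = 0 by rewrite /npart; case: leP => //; lia.
have -> : (npart 2 (x - (N + 1)))%:Z = 0 by rewrite /npart; case: leP => //; lia.
rewrite !mul0r !mulr0 !addr0; have [Lx|xL] := leP L x; last first.
  rewrite t1 ?updE // big1 // => k _.
  by rewrite /npart; case: eqP => [e|]; rewrite ?mul0r //; lia.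
have xk : (`|x - L| < `|N - L|)%N by lia.
have xE : x = L + `|x - L|%:Z by lia.
rewrite (bigD1 (Ordinal xk)) //= -xE subrr mul1r big1 ?addr0 // => k kx.
rewrite /npart; case: eqP => [e|]; rewrite ?mul0r //.
by case/eqP: kx; apply: val_inj => /=; lia.
Qed.

(** C will be the set of Hilbert functions of finitely generated modules; only
    its closure properties matter for the decomposition. *)
Section Decomposition.
Variable C : (zdeg n -> int) -> Prop.
Hypothesis C0 : C (fun=> 0).
Hypothesis CD : forall h h', C h -> C h' -> C (fun a => h a + h' a).
Hypothesis C_npart : forall (e : 'I_n -> nat) (c : zdeg n),
  (forall i, (e i <= m i)%N) ->
  C (fun a => (\prod_i npart (e i) (a i - c i))%:Z).

Lemma C_ext h h' : C h -> h =1 h' -> C h'.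
Proof. by move=> Ch /funext <-. Qed.

Lemma C_sum (r : nat) (h : 'I_r -> zdeg n -> int) :
  (forall k, C (h k)) -> C (fun a => \sum_(k < r) h k a).
Proof.
elim: r h => [|r IH] h Ch.
  by apply: C_ext C0 _ => a; rewrite big_ord0.
have := CD (IH _ (fun k => Ch (widen_ord (leqnSn r) k))) (Ch ord_max).
by move=> /C_ext; apply => a; rewrite big_ord_recr.
Qed.

Definition restr (s : seq 'I_n) a : zdeg n :=
  [ffun i => if i \in s then a i else 0].

Lemma restr_cons i s a : restr (i :: s) a = upd (restr s a) i (a i).
Proof. by apply/ffunP => j; rewrite !ffunE in_cons; case: eqP => [->|]. Qed.

(** The directions outside s are already split off: their contribution is a
    product of values of npart, and G sees only the entries in s.  Applying
    [tame_expand] in one more direction replaces G by restrictions of G to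
    hyperplanes and by a difference of two such restrictions, which are again
    nonnegative and tame in the remaining directions. *)
Lemma C_partial L N (s : seq 'I_n) (G : zdeg n -> int) (e : 'I_n -> nat)
    (c : zdeg n) :
  L <= N -> uniq s -> (forall a, 0 <= G a) ->
  (forall i, i \in s -> tame L N i G) ->
  (forall i, (e i <= m i)%N) ->
  C (fun a =>
    (\prod_(i | i \notin s) npart (e i) (a i - c i))%:Z * G (restr s a)).
Proof.
move=> LN; elim: s => [|i s IH] in G e c * => us G0 tG e_le.
  (* G is evaluated at 0 only: the function is a natural multiple of a
     basic function. *)
  have -> : (fun a => (\prod_(i | i \notin [::]) npart (e i) (a i - c i))%:Z *
      G (restr [::] a)) =
      (fun a => (\prod_i npart (e i) (a i - c i))%:Z * `|G 0%R|%N%:Z).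
    apply: funext => a; congr (_ * _); rewrite gez0_abs //; congr (G _);
    by apply/ffunP => i; rewrite !ffunE.
  elim: `|G 0%R|%N => [|k IHk]; first by apply: C_ext C0 _ => a; rewrite mulr0.
  apply: C_ext (CD IHk (C_npart c e_le)) _ => a.
  have -> : k.+1%:Z = k%:Z + 1 by lia.
  by rewrite mulrDr mulr1.
case/andP: us => is_ us.
(* Induction with the factor of the new direction i moved into the product. *)
have step e0 c0 (G' : zdeg n -> int) : (e0 <= m i)%N -> (forall a, 0 <= G' a) ->
    (forall j, j \in s -> tame L N j G') ->
    C (fun a => (\prod_(j | j \notin i :: s) npart (e j) (a j - c j))%:Z *
                ((npart e0 (a i - c0))%:Z * G' (restr s a))).
  move=> e0m G'0 tG'.
  have h := IH G' (fun j => if j == i then e0 else e j) (upd c i c0) us G'0 tG'.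
  apply: C_ext (h _) _ => [j|a]; first by case: eqP => [->|].
  rewrite mulrA; congr (_ * _); rewrite (bigD1 i) //= eqxx updE PoszM mulrC.
  congr (Posz _ * _); apply: eq_big => [j|j /andP [_ /negbTE ji]].
    by rewrite in_cons negb_or andbC.
  by rewrite ji ffunE ji.
have ti : tame L N i G by apply: tG; rewrite mem_head.
have ts x j : j \in s -> tame L N j (fun b => G (upd b i x)).
  move=> js; apply: tame_upd; last by apply: tG; rewrite in_cons js orbT.
  by apply: contraNneq is_ => ->.
have h0 := C_sum (fun k : 'I_`|N - L| => step 0%N (L + k%:Z)
  (fun b => G (upd b i (L + k%:Z))) isT (fun a => G0 _) (ts _)).
have h1 : C (fun a => (0 < m i)%:R *
    ((\prod_(j | j \notin i :: s) npart (e j) (a j - c j))%:Z *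
     ((npart 1 (a i - N))%:Z * G (upd (restr s a) i N)))).
  case: ltnP => mi; last by apply: C_ext C0 _ => a; rewrite mul0r.
  apply: C_ext (step 1%N N (fun b => G (upd b i N)) mi (fun a => G0 _) (ts _)) _.
  by move=> a; rewrite mul1r.
have h2 : C (fun a => (1 < m i)%:R *
    ((\prod_(j | j \notin i :: s) npart (e j) (a j - c j))%:Z *
     ((npart 2 (a i - (N + 1)))%:Z *
      (G (upd (restr s a) i (N + 1)) - G (upd (restr s a) i N))))).
  case: ltnP => mi; last by apply: C_ext C0 _ => a; rewrite mul0r.
  apply: C_ext (step 2%N (N + 1)
    (fun b => G (upd b i (N + 1)) - G (upd b i N)) mi _ _) _.
  - move=> a; apply: tame_nonneg_step ti _ G0; have := m_le2 i; lia.
  - by move=> j js; apply: tameB; apply: ts.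
  - by move=> a; rewrite mul1r.
apply: C_ext (CD (CD h0 h1) h2) _ => a.
rewrite restr_cons (tame_expand _ (a i) LN ti) -mulr_sumr; ring.
Qed.

Lemma nonneg_laurent_decomposition H : (forall a, 0 <= H a) ->
  is_laurent_poly (H * \prod_(i < n) (1 - tvar i) ^+ m i) -> C H.
Proof.
move=> H0 /laurent_poly_tame [L [N [LN tH]]].
have := C_partial 0 LN (enum_uniq 'I_n) H0 (fun i _ => tH i)
  (fun i => leq0n (m i)).
move/C_ext; apply => a; rewrite big_pred0 ?mul1r => [|i]; last by rewrite mem_enum.
by congr (H _); apply/ffunP => i; rewrite ffunE mem_enum.
Qed.

End Decomposition.
End Eventually.

(** * Monomials of a given degree in at most two variables per direction *)

Section CountMonomials.

(** The j-th summand in the t-th way of writing b as a sum of k <= 2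
    naturals. *)
Definition part_entry (k : nat) (b : int) (t j : nat) : nat :=
  if j == 0%N then (if k == 1%N then `|b|%N else t) else (`|b| - t)%N.

Lemma sum_part_entry k b t : (k <= 2)%N -> (t < npart k b)%N ->
  \sum_(j < k) (part_entry k b t j)%:Z = b.
Proof.
case: k => [|[|[|]]] //= _; rewrite /npart ?(big_ord_recl, big_ord0) /part_entry /=.
- by case: eqP.
- by case: leP => //; lia.
- by case: leP => //; lia.
Qed.

Lemma part_entry_surj k b (v : 'I_k -> nat) : (k <= 2)%N ->
  \sum_j (v j)%:Z = b ->
  exists2 t, (t < npart k b)%N & forall j, v j = part_entry k b t j.
Proof.
case: k v => [|[|[|]]] //= v _ <-; rewrite ?(big_ord_recl, big_ord0) /npart.
- by exists 0%N => // -[].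
- exists 0%N; first by case: leP => //; lia.
  by move=> j; rewrite addr0 [j]ord1; congr v; apply: val_inj.
- exists (v ord0); first by case: leP => //; lia.
  move=> j; case: (unliftP ord0 j) => [j'|] -> //.
  by rewrite (_ : j' = ord0) ?[LHS]ord1 // /part_entry /=; lia.
Qed.

Lemma part_entry_inj k b t t' : (k <= 2)%N ->
  (t < npart k b)%N -> (t' < npart k b)%N ->
  (forall j : 'I_k, part_entry k b t j = part_entry k b t' j) -> t = t'.
Proof.
case: k => [|[|[|]]] //= _; rewrite /npart.
- by case: eqP => //; lia.
- by case: leP => //; lia.
- by move=> _ _ /(_ ord0).
Qed.

Lemma npart_le k b : (npart k b <= `|b|.+1)%N.
Proof.
by case: k => [|[|k]]; rewrite /npart //=; [case: eqP|case: leP|case: leP].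
Qed.

(** A monomial of degree b is an independent choice, for each direction i, of a
    way of writing b i as a sum of e i exponents. *)
Lemma enum_monomials n (e : 'I_n -> nat) (b : zdeg n) :
  (forall i, (e i <= 2)%N) ->
  exists (T : finType) (mon : T -> {cmonom var_index e}),
    [/\ injective mon, forall u, mon_deg u = b <-> exists t, mon t = u
      & #|T| = (\prod_i npart (e i) (b i))%N].
Proof.
move=> e_le2; pose B := (\sum_i `|b i|)%N.
have B_ge i : (npart (e i) (b i) <= B.+1)%N.
  by apply: leq_trans (npart_le _ _) _; rewrite ltnS /B (bigD1 i) //= leq_addr.
pose A : {pred {ffun 'I_n -> 'I_B.+1}} :=
  family (fun i => [pred k : 'I_B.+1 | (k < npart (e i) (b i))%N]).
pose mon (f : {f | f \in A}) : {cmonom var_index e} :=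
  mk_mon (fun x : var_index e =>
    part_entry (e (tag x)) (b (tag x)) (val f (tag x))
      (tagged x : 'I_(e (tag x)))).
have mem_A (f : {f | f \in A}) i : (val f i < npart (e i) (b i))%N.
  by have /familyP /(_ i) := valP f; rewrite inE.
exists {f | f \in A}, mon; split.
- move=> f f' ff'; apply/val_inj/ffunP => i; apply: ord_inj.
  apply: (part_entry_inj (e_le2 i) (mem_A f i) (mem_A f' i)) => j.
  have := congr1
    (fun u : {cmonom var_index e} => u (Tagged (fun i => 'I_(e i)) j)) ff'.
  by rewrite !mk_monE.
- move=> u; split=> [ub|[f <-]]; last first.
    apply/ffunP => i; rewrite ffunE -[RHS](sum_part_entry (e_le2 i) (mem_A f i)).
    by apply: eq_bigr => j _; rewrite mk_monE.
  have /choice [t t_P] : forall i, exists t, (t < npart (e i) (b i))%N /\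
      forall j : 'I_(e i),
        u (Tagged (fun i => 'I_(e i)) j) = part_entry (e i) (b i) t j.
    move=> i; have := congr1 (fun a : zdeg n => a i) ub; rewrite ffunE.
    by move=> /(part_entry_surj (e_le2 i)) [t]; exists t.
  have fA : [ffun i => inord (t i)] \in A.
    apply/familyP => i; rewrite inE ffunE; have [ti _] := t_P i.
    by rewrite inordK // (leq_trans ti).
  exists (exist (fun f => f \in A) _ fA); apply: monP => -[i j].
  rewrite mk_monE /= ffunE.
  by have [ti ->] := t_P i; rewrite inordK // (leq_trans ti).
rewrite card_sig card_family foldrE big_map big_enum.
apply: eq_bigr => i _; rewrite -[RHS]card_ord -!sum1_card.
by rewrite (big_ord_narrow (B_ge i)).
Qed.

End CountMonomials.

(** * Realizable series: zero and sums *)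

(** Stated for functions rather than Laurent series, so that sums of Hilbert
    series need no bound on their support. *)
Definition realizable (K : fieldType) n (m : 'I_n -> nat) (h : zdeg n -> int) :=
  exists (M : lmodType (gpoly K m)) (gr : grading M), fin_gen M /\
    forall a, exists2 d, Kdim (gr a) d & h a = d%:Z.

(** The axiom [piece_sum] of a grading wants one summand per degree; it is
    enough to write an element as any sum of homogeneous elements. *)
Lemma homog_sum_exists n (M : zmodType) (P : zdeg n -> set M) (I : Type)
    (r : seq I) (deg : I -> zdeg n) (z : I -> M) :
  (forall a, P a 0) -> (forall a x y, P a x -> P a y -> P a (x - y)) ->
  (forall i, P (deg i) (z i)) ->
  exists (s : seq (zdeg n)) (y : zdeg n -> M),
    (forall a, P a (y a)) /\ \sum_(i <- r) z i = \sum_(a <- s) y a.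
Proof.
move=> P0 PB Pz.
exists (undup (map deg r)), (fun a => \sum_(i <- r | deg i == a) z i); split.
  move=> a; apply: (big_ind (P a)) => [//|x y Px Py|i /eqP <- //].
  by rewrite -[y]opprK; apply: (PB) => //; rewrite -sub0r; apply: PB.
apply: sum_by_degree; first exact: undup_uniq.
have := allss (map deg r); rewrite all_map; apply: sub_all => i /=.
by rewrite mem_undup.
Qed.

Section ZeroModule.
Variables (K : fieldType) (n : nat) (m : 'I_n -> nat).
Local Notation M0 := 'rV[gpoly K m]_0.

Lemma zero_grading_sum (x : M0) : exists (s : seq (zdeg n)) (y : zdeg n -> M0),
  (forall a, setT (y a)) /\ x = \sum_(a <- s) y a.
Proof. by exists [::], (fun=> 0); split => //; rewrite big_nil thinmx0. Qed.

Lemma zero_grading_direct (s : seq (zdeg n)) (y : zdeg n -> M0) : uniq s ->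
  (forall a, setT (y a)) -> \sum_(a <- s) y a = 0 -> forall a, a \in s -> y a = 0.
Proof. by move=> *; exact: thinmx0. Qed.

Definition zero_grading : grading M0 :=
  @Grading K n m M0 (fun=> setT) (fun _ => I) (fun _ _ _ _ _ => I)
    (fun _ _ _ _ _ _ => I) zero_grading_sum zero_grading_direct.

Lemma realizable0 : realizable K m (fun=> 0).
Proof.
exists M0, zero_grading; split.
  exists 0%N, (fun=> 0) => x; exists (fun=> 0).
  by rewrite big_ord0; exact: thinmx0.
move=> a; exists 0%N => //; exists (fun=> 0); split=> // [c _ []//|x _].
by exists (fun=> 0); rewrite big_ord0; exact: thinmx0.
Qed.
End ZeroModule.

Section SumModule.
Variables (K : fieldType) (n : nat) (m : 'I_n -> nat).
Variables (M1 M2 : lmodType (gpoly K m)) (g1 : grading M1) (g2 : grading M2).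
Local Notation MM := (M1 * M2)%type.

Definition sum_piece (a : zdeg n) : set MM :=
  [set x | g1 a x.1 /\ g2 a x.2]%classic.

Lemma sum_piece0 a : sum_piece a 0.
Proof. by split; exact: piece0. Qed.

Lemma sum_pieceB a x y : sum_piece a x -> sum_piece a y -> sum_piece a (x - y).
Proof. by move=> [x1 x2] [y1 y2]; split; apply: pieceB. Qed.

Lemma sum_pieceZ a b p x :
  homog a p -> sum_piece b x -> sum_piece (a + b) (p *: x).
Proof. by move=> pa [x1 x2]; split; apply: pieceZ. Qed.

Lemma fst_sum (I : Type) (r : seq I) (z : I -> MM) :
  (\sum_(i <- r) z i).1 = \sum_(i <- r) (z i).1.
Proof. exact: (big_morph (fun x : MM => x.1)). Qed.

Lemma snd_sum (I : Type) (r : seq I) (z : I -> MM) :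
  (\sum_(i <- r) z i).2 = \sum_(i <- r) (z i).2.
Proof. exact: (big_morph (fun x : MM => x.2)). Qed.

Lemma fst_sum_split d1 d2 (F : 'I_(d1 + d2) -> MM) :
  (\sum_i F i).1 = \sum_j (F (lshift d2 j)).1 + \sum_j (F (rshift d1 j)).1.
Proof. by rewrite fst_sum; exact: big_split_ord. Qed.

Lemma snd_sum_split d1 d2 (F : 'I_(d1 + d2) -> MM) :
  (\sum_i F i).2 = \sum_j (F (lshift d2 j)).2 + \sum_j (F (rshift d1 j)).2.
Proof. by rewrite snd_sum; exact: big_split_ord. Qed.

Lemma sum_piece_sum (x : MM) : exists (s : seq (zdeg n)) (y : zdeg n -> MM),
  (forall a, sum_piece a (y a)) /\ x = \sum_(a <- s) y a.
Proof.
have [s1 [y1 [y1P x1E]]] := piece_sum g1 x.1.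
have [s2 [y2 [y2P x2E]]] := piece_sum g2 x.2.
pose z (i : zdeg n + zdeg n) : MM :=
  match i with inl a => (y1 a, 0) | inr a => (0, y2 a) end.
pose deg (i : zdeg n + zdeg n) := match i with inl a => a | inr a => a end.
have zP i : sum_piece (deg i) (z i).
  by case: i => a; split=> //; exact: piece0.
have [s [y [yP yE]]] := homog_sum_exists (map inl s1 ++ map inr s2)
  sum_piece0 sum_pieceB zP.
exists s, y; split => //; rewrite -yE; apply: injective_projections.
  rewrite x1E fst_sum big_cat !big_map.
  have -> : \sum_(a <- s2) (z (inr a)).1 = 0 by exact: big1.
  exact: esym (addr0 _).
rewrite x2E snd_sum big_cat !big_map.
have -> : \sum_(a <- s1) (z (inl a)).2 = 0 by exact: big1.
exact: esym (add0r _).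
Qed.

Lemma sum_piece_direct (s : seq (zdeg n)) (y : zdeg n -> MM) : uniq s ->
  (forall a, sum_piece a (y a)) -> \sum_(a <- s) y a = 0 ->
  forall a, a \in s -> y a = 0.
Proof.
move=> us yP y0 a as_; apply: injective_projections.
  apply: (piece_direct (g := g1) us (y := fun a => (y a).1)) as_ => [b|].
    by case: (yP b).
  by rewrite -fst_sum y0.
apply: (piece_direct (g := g2) us (y := fun a => (y a).2)) as_ => [b|].
  by case: (yP b).
by rewrite -snd_sum y0.
Qed.

Definition sum_grading : grading MM := Grading sum_piece0 sum_pieceB sum_pieceZ
  sum_piece_sum sum_piece_direct.

Lemma sum_fin_gen : fin_gen M1 -> fin_gen M2 -> fin_gen MM.
Proof.
case=> r1 [f1 f1P] [r2 [f2 f2P]].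
exists (r1 + r2)%N, (fun i =>
  match split i with inl j => (f1 j, 0) | inr j => (0, f2 j) end).
move=> x; have [c1 x1E] := f1P x.1; have [c2 x2E] := f2P x.2.
exists (fun i => match split i with inl j => c1 j | inr j => c2 j end).
apply: injective_projections.
  rewrite x1E fst_sum_split [X in _ + X]big1 => [|j _].
    rewrite addr0; apply: eq_bigr => j _.
    by rewrite (unsplitK (inl j)).
  by rewrite (unsplitK (inr j)); exact: scaler0.
rewrite x2E snd_sum_split [X in X + _]big1 => [|j _].
  rewrite add0r; apply: eq_bigr => j _.
  by rewrite (unsplitK (inr j)).
by rewrite (unsplitK (inl j)); exact: scaler0.
Qed.

Lemma sum_Kdim a d1 d2 : Kdim (g1 a) d1 -> Kdim (g2 a) d2 ->
  Kdim (sum_grading a) (d1 + d2).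
Proof.
case=> f1 [f1_in f1_free f1_span] [f2 [f2_in f2_free f2_span]].
pose f (i : 'I_(d1 + d2)) : MM :=
  match split i with inl j => (f1 j, 0) | inr j => (0, f2 j) end.
have fst_f (c : 'I_(d1 + d2) -> K) :
    (\sum_i (c i)%:A *: f i).1 = \sum_j (c (lshift d2 j))%:A *: f1 j.
  rewrite fst_sum_split [X in _ + X]big1 => [|j _].
    rewrite addr0; apply: eq_bigr => j _.
    by rewrite /f (unsplitK (inl j)).
  by rewrite /f (unsplitK (inr j)); exact: scaler0.
have snd_f (c : 'I_(d1 + d2) -> K) :
    (\sum_i (c i)%:A *: f i).2 = \sum_j (c (rshift d1 j))%:A *: f2 j.
  rewrite snd_sum_split [X in X + _]big1 => [|j _].
    rewrite add0r; apply: eq_bigr => j _.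
    by rewrite /f (unsplitK (inr j)).
  by rewrite /f (unsplitK (inl j)); exact: scaler0.
exists f; split.
- move=> i; change (sum_piece a (f i)); rewrite /f.
  by case: (split i) => j; split; first [exact: f1_in|exact: f2_in|exact: piece0].
- move=> c c0 i; rewrite -(splitK i); case: (split i) => j.
    by apply: (f1_free (fun j => c (lshift d2 j))); rewrite -fst_f c0.
  by apply: (f2_free (fun j => c (rshift d1 j))); rewrite -snd_f c0.
- move=> x [/f1_span [c1 x1E] /f2_span [c2 x2E]].
  exists (fun i => match split i with inl j => c1 j | inr j => c2 j end).
  apply: injective_projections; [rewrite fst_f x1E|rewrite snd_f x2E].
    by apply: eq_bigr => j _; rewrite (unsplitK (inl j)).
  by apply: eq_bigr => j _; rewrite (unsplitK (inr j)).
Qed.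

End SumModule.

Lemma realizableD (K : fieldType) n (m : 'I_n -> nat) h h' :
  realizable K m h -> realizable K m h' -> realizable K m (fun a => h a + h' a).
Proof.
case=> M1 [g1 [fg1 h1]] [M2 [g2 [fg2 h2]]].
exists (M1 * M2)%type, (sum_grading g1 g2); split; first exact: sum_fin_gen.
move=> a; have [d1 K1 ->] := h1 a; have [d2 K2 ->] := h2 a.
by exists (d1 + d2)%N; [exact: sum_Kdim|].
Qed.

(** * Realizable series: shifted quotient rings *)

(** S as an R-module by restriction of scalars along f; the argument f selects
    the module structure. *)
Definition pullback (R S : nzRingType) (f : {rmorphism R -> S}) : Type := S.

HB.instance Definition _ (R S : nzRingType) (f : {rmorphism R -> S}) :=
  GRing.Zmodule.copy (pullback f) S.

Section Pullback.
Variables (R S : nzRingType) (f : {rmorphism R -> S}).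
Local Notation pullback := (pullback f).

Definition pullback_scale (r : R) (x : pullback) : pullback := f r * (x : S).

Lemma pullback_scaleA r s x :
  pullback_scale r (pullback_scale s x) = pullback_scale (r * s) x.
Proof. by rewrite /pullback_scale rmorphM mulrA. Qed.

Lemma pullback_scale1 : left_id 1 pullback_scale.
Proof. by move=> x; rewrite /pullback_scale rmorph1 mul1r. Qed.

Lemma pullback_scaleDr : right_distributive pullback_scale +%R.
Proof. by move=> r x y; exact: mulrDr. Qed.

Lemma pullback_scaleDl x : {morph pullback_scale^~ x : r s / r + s}.
Proof. by move=> r s; rewrite /pullback_scale rmorphD mulrDl. Qed.

HB.instance Definition _ := GRing.Zmodule_isLmodule.Build R pullback
  pullback_scaleA pullback_scale1 pullback_scaleDr pullback_scaleDl.

End Pullback.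

Section HomogPoly.
Variables (K : fieldType) (n : nat) (e : 'I_n -> nat).
Implicit Types (p q : gpoly K e) (u v : {cmonom var_index e}) (a b : zdeg n).

Lemma coef_monU u v : (<< u >> : gpoly K e)@_v = (u == v)%:R.
Proof. exact: mcoeffU1. Qed.

Lemma homog0 a : homog a (0 : gpoly K e).
Proof. by move=> u; rewrite mcoeff0 eqxx. Qed.

Lemma homogB a p q : homog a p -> homog a q -> homog a (p - q).
Proof.
move=> pa qa u; rewrite mcoeffB => nz.
have [pu|/pa //] := eqVneq p@_u 0; have [qu|/qa //] := eqVneq q@_u 0.
by rewrite pu qu subrr eqxx in nz.
Qed.

Lemma homogD a p q : homog a p -> homog a q -> homog a (p + q).
Proof.
move=> pa qa; rewrite -[q]opprK; apply: homogB => //.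
by rewrite -sub0r; apply: homogB => //; exact: homog0.
Qed.

Lemma homog_sum a (I : Type) (r : seq I) (P : pred I) (z : I -> gpoly K e) :
  (forall i, P i -> homog a (z i)) -> homog a (\sum_(i <- r | P i) z i).
Proof.
move=> h; apply: (big_ind (homog a)) => //; first exact: homog0.
exact: homogD.
Qed.

Lemma homogZ a c p : homog a p -> homog a (c *: p).
Proof. by move=> pa u; rewrite mcoeffZ mulf_eq0 negb_or => /andP [_ /pa]. Qed.

Lemma homog_mon a u : mon_deg u = a -> homog a (<< u >> : gpoly K e).
Proof. by move=> <-; exact: homogU. Qed.

Lemma homogM a b p q : homog a p -> homog b q -> homog (a + b) (p * q).
Proof.
move=> pa qb; rewrite (malg_expand p) mulr_suml big_seq; apply: homog_sum => u.
rewrite -mcoeff_neq0 => /pa ua.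
rewrite (malg_expand q) mulr_sumr big_seq; apply: homog_sum => v.
rewrite -mcoeff_neq0 => /qb vb.
rewrite -scalerAl -scalerAr; do 2!apply: homogZ.
by rewrite (monU_mul K u v); apply: homog_mon; rewrite mon_degM ua vb.
Qed.

End HomogPoly.

(** The ring morphism from K[X_ij, j < m i] onto K[X_ij, j < e i] that sends
    the other variables to 0.  Restricting scalars along it makes the target
    the quotient of the source by those variables. *)
Section Specialize.
Variables (K : fieldType) (n : nat) (m e : 'I_n -> nat).
Hypothesis e_le : forall i, (e i <= m i)%N.
Local Notation Vm := (var_index m).
Local Notation Ve := (var_index e).
Implicit Types (u v : {cmonom Vm}) (w : {cmonom Ve}).

Definition widen_var (y : Ve) : Vm :=
  Tagged (fun i => 'I_(m i)) (widen_ord (e_le (tag y)) (tagged y)).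

Lemma widen_var_inj : injective widen_var.
Proof.
move=> [i j] [i' j'] E; have ii' : i = i' by exact: (congr1 (@tag _ _) E).
case: _ / ii' in j' E *; congr existT.
have /eqP := E; rewrite /widen_var eq_Tagged /= => /eqP /(congr1 val) /=.
exact: val_inj.
Qed.

(** The monomials that the morphism does not send to 0. *)
Definition kept u :=
  [forall x : Vm, (e (tag x) <= (tagged x : 'I_(m (tag x))))%N ==> (u x == 0%N)].

Lemma keptP u :
  reflect (forall x : Vm,
             (e (tag x) <= (tagged x : 'I_(m (tag x))))%N -> u x = 0%N)
          (kept u).
Proof.
apply: (iffP forallP) => h x; first by move=> le; move: (h x); rewrite le => /eqP.
by apply/implyP => /h ->.
Qed.

Definition narrow_mon u : {cmonom Ve} := mk_mon (fun y => u (widen_var y)).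

Definition special_mon u : gpoly K e := if kept u then << narrow_mon u >> else 0.

Lemma special_mon_mmorphism : mmorphism special_mon.
Proof.
split=> [u v|]; last first.
  rewrite /special_mon; have -> : kept mone by apply/keptP => x _; rewrite cm1.
  have -> : narrow_mon mone = mone by apply: monP => y; rewrite mk_monE !cm1.
  exact: erefl.
rewrite /special_mon; have -> : kept (mmul u v) = kept u && kept v.
  apply/keptP/andP => [h|[/keptP hu /keptP hv] x le]; last by rewrite cmM hu ?hv.
  split; apply/keptP => x /h; rewrite cmM => /eqP; rewrite addn_eq0.
    by case/andP => /eqP.
  by case/andP => _ /eqP.
case: (kept u); last by rewrite mul0r.
case: (kept v); last by rewrite mulr0.
have E : narrow_mon (mmul u v) = mmul (narrow_mon u) (narrow_mon v).
  by apply: monP => y; rewrite cmM !mk_monE cmM.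
by rewrite E; exact: esym (monU_mul K _ _).
Qed.

HB.instance Definition _ := isMultiplicative.Build {cmonom Vm} (gpoly K e)
  special_mon special_mon_mmorphism.

Definition specialize : {rmorphism gpoly K m -> gpoly K e} :=
  mmap (@mkmalgU _ K mone) special_mon.

Lemma mon_deg_narrow u : kept u -> mon_deg (narrow_mon u) = mon_deg u.
Proof.
move/keptP => ku; apply/ffunP => i; rewrite !ffunE.
pose ui (j : 'I_(m i)) := (u (Tagged (fun i => 'I_(m i)) j))%:Z.
rewrite (eq_bigr (fun j => ui (widen_ord (e_le i) j)));
  last by move=> j _; rewrite mk_monE.
rewrite -(big_ord_narrow (F := ui) (e_le i)).
rewrite big_mkcond; apply: eq_bigr => j _; case: ltnP => // le.
by rewrite ku.
Qed.

Lemma homog_specialize a p : homog a p -> homog a (specialize p).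
Proof.
move=> pa; rewrite /specialize /= mmapE big_seq; apply: homog_sum => u.
rewrite -mcoeff_neq0 => /pa ua; rewrite mul_malgC; apply: homogZ.
rewrite /special_mon; case: ifP => ku; last exact: homog0.
by apply: homog_mon; rewrite mon_deg_narrow.
Qed.

Lemma specializeC k : specialize (k%:A) = k%:A.
Proof.
have E (e' : 'I_n -> nat) : k%:A = k%:MP :> gpoly K e'.
  by rewrite -mul_malgC mulr1.
rewrite !E; exact: mmapC.
Qed.

(** A preimage of the monomial w; the sum over y has at most one summand. *)
Definition widen_mon w : {cmonom Vm} :=
  mk_mon (fun x => \sum_(y : Ve | widen_var y == x) w y)%N.

Lemma special_widen_mon w : special_mon (widen_mon w) = << w >>.
Proof.
rewrite /special_mon; have -> : kept (widen_mon w).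
  apply/keptP => x le; rewrite mk_monE big1 // => y /eqP yx.
  by have := ltn_ord (tagged y); rewrite ltnNge; case/negP; move: le; rewrite -yx.
suff -> : narrow_mon (widen_mon w) = w by [].
apply: monP => y; rewrite !mk_monE (bigD1 y) // big1; first exact: addn0.
by move=> y' /andP [/eqP /widen_var_inj -> /eqP].
Qed.

Lemma specialize_surj (q : gpoly K e) : exists p, specialize p = q.
Proof.
exists (\sum_(w <- msupp q) << q@_w *g widen_mon w >>).
rewrite raddf_sum [RHS]malg_expand; apply: eq_bigr => w _.
apply: (etrans (mmapU _ _)).
apply: (etrans (congr1 (fun z => _ * z) (special_widen_mon w))).
exact: mul_malgC.
Qed.

End Specialize.

(** The target of [specialize], with the degrees shifted by c. *)
Section ShiftedQuotient.
Variables (K : fieldType) (n : nat) (m e : 'I_n -> nat).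
Hypothesis e_le : forall i, (e i <= m i)%N.
Variable c : zdeg n.
Local Notation M := (pullback (specialize K e_le)).

Definition shift_piece (a : zdeg n) : set M :=
  fun x => homog (a - c) (x : gpoly K e).

Lemma shift_piece0 a : shift_piece a 0.
Proof. exact: homog0. Qed.

Lemma shift_pieceB a x y :
  shift_piece a x -> shift_piece a y -> shift_piece a (x - y).
Proof. exact: homogB. Qed.

Lemma shift_pieceZ a b p x :
  homog a p -> shift_piece b x -> shift_piece (a + b) (p *: x).
Proof.
move=> pa xb; rewrite /shift_piece -addrA.
change (homog (a + (b - c)) (specialize K e_le p * (x : gpoly K e))).
by apply: homogM => //; exact: homog_specialize.
Qed.

Lemma shift_piece_sum (x : M) : exists (s : seq (zdeg n)) (y : zdeg n -> M),
  (forall a, shift_piece a (y a)) /\ x = \sum_(a <- s) y a.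
Proof.
have zP (u : {cmonom var_index e}) :
    shift_piece (mon_deg u + c) ((x : gpoly K e)@_u *: << u >> : gpoly K e).
  by rewrite /shift_piece addrK; apply: homogZ; exact: homog_mon.
have [s [y [yP yE]]] := homog_sum_exists (msupp (x : gpoly K e))
  shift_piece0 shift_pieceB zP.
by exists s, y; split => //; rewrite -yE; exact: (malg_expand (x : gpoly K e)).
Qed.

Lemma shift_piece_direct (s : seq (zdeg n)) (y : zdeg n -> M) : uniq s ->
  (forall a, shift_piece a (y a)) -> \sum_(a <- s) y a = 0 ->
  forall a, a \in s -> y a = 0.
Proof.
move=> us yP y0 a as_; apply: (proj1 (malgP (y a : gpoly K e) 0)) => u.
rewrite mcoeff0; apply: contrapT => /eqP nz.
have ua := yP a u nz; case/eqP: (nz).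
have {y0} := congr1 (fun x : M => (x : gpoly K e)@_u) y0.
rewrite (raddf_sum (mcoeff u)) (bigD1_seq a) // big1 => [E|b ba].
  by move: E; rewrite mcoeff0 => <-; exact: esym (addr0 _).
apply: contrapT => /eqP /(yP b u) ub; case/eqP: ba.
by apply: (addIr (- c)); rewrite -ub.
Qed.

Definition shift_grading : grading M :=
  Grading shift_piece0 shift_pieceB shift_pieceZ
  shift_piece_sum shift_piece_direct.

Lemma shift_fin_gen : fin_gen M.
Proof.
exists 1%N, (fun=> 1 : gpoly K e) => x.
have [p pE] := specialize_surj e_le (x : gpoly K e).
exists (fun=> p); rewrite big_ord1 -pE; exact: esym (mulr1 _).
Qed.

Lemma pullback_scaleC k (x : M) : k%:A *: x = (k *: (x : gpoly K e)) :> gpoly K e.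
Proof.
apply: (etrans (congr1 (fun z => z * (x : gpoly K e)) (specializeC e_le k))).
by rewrite -scalerAl mul1r.
Qed.

(** The monomials of degree a - c form a basis of the piece of degree a. *)
Lemma shift_Kdim a (T : finType) (mon : T -> {cmonom var_index e}) :
  injective mon -> (forall u, mon_deg u = a - c <-> exists t, mon t = u) ->
  Kdim (shift_grading a) #|T|.
Proof.
move=> mon_inj mon_P.
pose f (i : 'I_#|T|) : M := << mon (enum_val i) >>.
have coef_f (k : 'I_#|T| -> K) u :
    ((\sum_i (k i)%:A *: f i : M) : gpoly K e)@_u =
    \sum_i k i * (mon (enum_val i) == u)%:R.
  rewrite (raddf_sum (mcoeff u)); apply: eq_bigr => i _.
  apply: (etrans (congr1 (mcoeff u) (pullback_scaleC (k i) (f i)))).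
  apply: (etrans (mcoeffZ _ _ _)).
  by apply: congr1; exact: coef_monU.
have coef_f_mon (k : 'I_#|T| -> K) i :
    ((\sum_i (k i)%:A *: f i : M) : gpoly K e)@_(mon (enum_val i)) = k i.
  rewrite coef_f (bigD1 i) // big1 => [|j ji]; last first.
    by rewrite (inj_eq mon_inj) (inj_eq enum_val_inj) (negbTE ji) mulr0.
  by apply: (etrans (addr0 _)); rewrite eqxx mulr1.
exists f; split.
- by move=> i; apply: homog_mon; apply/mon_P; exists (enum_val i).
- by move=> k k0 i; rewrite -(coef_f_mon k) k0; exact: mcoeff0.
- move=> x xa; exists (fun i => (x : gpoly K e)@_(mon (enum_val i))).
  apply: (proj1 (malgP (x : gpoly K e) _)) => u.
  have [[t <-]|nt] := pselect (exists t, mon t = u).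
    by rewrite -[t]enum_rankK coef_f_mon.
  rewrite coef_f big1 => [|i _].
    by apply: contrapT => /eqP /xa /mon_P.
  by case: eqP => [E|]; rewrite ?mulr0 //; case: nt; exists (enum_val i).
Qed.

End ShiftedQuotient.

Lemma realizable_npart (K : fieldType) n (m e : 'I_n -> nat) (c : zdeg n) :
  (forall i, (m i <= 2)%N) -> (forall i, (e i <= m i)%N) ->
  realizable K m (fun a => (\prod_i npart (e i) (a i - c i))%:Z).
Proof.
move=> m_le2 e_le.
exists (pullback (specialize K e_le)), (shift_grading K e_le c).
split; first exact: shift_fin_gen.
move=> a; have e_le2 i : (e i <= 2)%N by exact: leq_trans (e_le i) (m_le2 i).
have [T [mon [mon_inj mon_P cardT]]] := enum_monomials (a - c) e_le2.
exists #|T|; first exact: shift_Kdim mon_inj mon_P.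
by rewrite cardT; congr Posz; apply: eq_bigr => i _; rewrite !ffunE.
Qed.

Theorem corollary3p14 (K : fieldType) (n : nat) (m : 'I_n -> nat)
    (m_le2 : forall i, (m i <= 2)%N) (H : laurent n) :
  (exists (M : lmodType (gpoly K m)) (gr : grading M),
     fin_gen M /\ is_hilbert_series gr H)
  <->
  ((forall a, 0 <= H a) /\
   is_laurent_poly (H * \prod_(i < n) (1 - tvar i) ^+ m i)).
Proof.
split=> [[M [gr [fgM HM]]]|[H_ge0 H_poly]].
  split; last exact: hilbert_series_laurent_poly fgM HM.
  by move=> a; have [d _ ->] := HM a.
apply: (nonneg_laurent_decomposition m_le2 (realizable0 K m) _ _ H_ge0 H_poly).
  by move=> h h'; exact: realizableD.
by move=> e c; exact: realizable_npart.
Qed.
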